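(* A Damek--Ricci space $S$ is symmetric if and only if it has the property that whenever two focal varieties $\mathcal F_{\circledast}^{\eta_1}$ and $\mathcal F_{\circledast}^{\eta_2}$ intersect a geodesic orthogonally at the same point, they coincide.
   Context: Damek--Ricci space: let $\mathfrak s=\mathfrak v\oplus\mathfrak z\oplus\mathfrak a$ be an orthogonal decomposition of a finite-dimensional Euclidean space $(\mathfrak s,\langle\,,\rangle)$ with $\mathfrak a=\mathbb RA$, $\|A\|=1$, $n=\dim\mathfrak v$, $m=\dim\mathfrak z$ (either may be $0$). Let $J$ be a representation on $\mathfrak v$ of the Clifford algebra $\mathrm{Cl}(\mathfrak z,q)$ of $q(Z)=-\langle Z,Z\rangle$ with $\|J_ZV\|=\|Z\|\|V\|$. The Lie bracket on $\mathfrak s$ is determined by $\langle[U,V],Z\rangle=\langle J_ZU,V\rangle$ with $[U,V]\in\mathfrak z$ for $U,V\in\mathfrak v$, $Z\in\mathfrak z$; $[\mathfrak v\oplus\mathfrak z,\mathfrak z]=0$; $[A,V]=\frac12V$ for $V\in\mathfrak v$; $[A,Z]=Z$ for $Z\in\mathfrak z$. The simply connected Lie group $S$ with Lie algebra $\mathfrak s$ and the left-invariant metric induced by $\langle\,,\rangle$ is the Damek--Ricci space. ''Symmetric'' means Riemannian symmetric space. Half-space model: $S$ is identified with $\mathfrak v\oplus\mathfrak z\times\mathbb R_+\subset\mathfrak v\oplus\mathfrak z\oplus\mathbb R\cong\mathfrak s$ via $(V,Z,t)\mapsto\exp(V+Z)\exp((\ln t)A)$; $e=(0,0,1)$; $(v,z,s)\in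 T_eS$ means $v+z+sA$. The left translation by $(\bar V,\bar Z,\bar t)\in S$ is $L_{(\bar V,\bar Z,\bar t)}(V,Z,t)=(\bar V+\sqrt{\bar t}V,\ \bar Z+\bar tZ+\frac12\sqrt{\bar t}[\bar V,V],\ \bar tt)$, which extends to $\mathfrak v\oplus\mathfrak z\oplus\mathbb R$ and to the projective closure $\mathbf P(\mathfrak s\oplus\mathbb R)$. Focal varieties $\mathcal F_{\circledast}^{\eta}$: let $\gamma$ be the prolongation of the unit speed geodesic $\hat\gamma$ from $e$ with unit initial velocity $(v,0,s)$, $v\neq0$, i.e. the continuous extension to $\mathbb R\mathbf P^1\to\mathbf P(\mathfrak s\oplus\mathbb R)$ of $\gamma(\theta)=\left(\frac{2\theta}{1-s\theta}v,0,\frac{1-\theta^2}{(1-s\theta)^2}\right)$, for which $\hat\gamma(t)=\gamma(\tanh(t/2))$. For $\eta=L_{(\bar V,\bar Z,\bar t)}\circ\gamma$ with $(\bar V,\bar Z,\bar t)\in S$, put $\mathcal F_{\circledast}^{\eta}=\{(V,Z,t)\in S:[V-\bar V,v]=0,\ \langle V-\bar V,v\rangle=2s\sqrt{\bar t}\}$; it is the focal variety (zero set) of the isoparametric function $D_{\circledast}^{\eta}(V,Z,t)=\frac1t\left((2s\sqrt{\bar t}-\langle V-\bar V,v\rangle)^2+\|[V-\bar V,v]\|^2\right)$. *)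

(* Defs.v *)
From HB Require Import structures.
From mathcomp Require Import all_boot all_order all_algebra.
From mathcomp Require Import all_classical all_reals all_analysis.
Import Order.TTheory GRing.Theory Num.Theory.
Import numFieldNormedType.Exports.

Set Implicit Arguments.
Unset Strict Implicit.
Unset Printing Implicit Defensive.

Local Open Scope ring_scope.
Local Open Scope classical_set_scope.

(** Riemannian geometry of an open subset [S] of a finite-dimensional normed
    space [E], with a metric [g : E -> E -> E -> R] ([g p X Y] is the inner
    product of the tangent vectors [X] and [Y] at [p]).  Every tangent space is
    [E] itself; the values of [g] and of maps outside [S] are irrelevant. *)
Section RiemannianGeometry.
Variables (R : realType) (E : normedModType R).
Implicit Types (S F : set E) (g : E -> E -> E -> R) (f : E -> E) (p : E).

(* [C^k] through iterated directional derivatives. *)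
Fixpoint Ck S (k : nat) f : Prop :=
  if k is k'.+1 then
    (forall p, S p -> differentiable f p) /\
    (forall X : E, Ck S k' (fun p => 'D_X f p))
  else forall p, S p -> {for p, continuous f}.

Definition smooth_on S f : Prop := forall k, Ck S k f.

Definition isometry_of S g f : Prop :=
  [/\ smooth_on S f,
      forall p, S p -> S (f p),
      exists h : E -> E,
        [/\ smooth_on S h,
            forall p, S p -> S (h p),
            forall p, S p -> h (f p) = p &
            forall p, S p -> f (h p) = p] &
      forall p, S p -> forall X Y : E,
        g (f p) ('d f p X) ('d f p Y) = g p X Y].

Definition symmetric_space S g : Prop :=
  forall p, S p -> exists f, [/\ isometry_of S g f, f p = p &
    forall X : E, 'd f p X = - X].

(* The Levi-Civita connection on constant vector fields: the Koszul formula for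
   [g p (nabla_X Y) W] with [X], [Y], [W] constant (hence commuting). *)
Definition christoffel g p (X Y W : E) : R :=
  2^-1 * ('D_X (fun q => g q Y W) p + 'D_Y (fun q => g q X W) p
          - 'D_W (fun q => g q X Y) p).

(* Complete geodesics, of any constant positive speed; the equation is
   [nabla_{c'} c' = 0], tested against every tangent vector [W]. *)
Definition geodesic S g (c : R -> E) : Prop :=
  forall t : R,
    [/\ S (c t), derivable c t 1, derivable c^`() t 1, c^`() t != 0 &
        forall W : E, g (c t) (c^`()^`() t) W
          + christoffel g (c t) (c^`() t) (c^`() t) W = 0].

(* Velocities at [p] of the curves running in [F]: for an embedded submanifold
   [F] this is the tangent space of [F] at [p]. *)
Definition tangent_vectors F p : set E :=
  [set X | exists a : R -> E,
    [/\ a 0 = p, \forall t \near (0 : R), F (a t) & is_derive (0 : R) 1 a X]].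

Definition meets_orthogonally g F (c : R -> E) (t : R) : Prop :=
  F (c t) /\
  forall X : E, tangent_vectors F (c t) X -> g (c t) (c^`() t) X = 0.

End RiemannianGeometry.

Section DamekRicci.
Variable R : realType.

(* The norm [`|u|] of ['rV[R]_k] is the sup norm, hence these definitions. *)
Definition dot k (u v : 'rV[R]_k) : R := \sum_(i < k) u 0 i * v 0 i.
Definition enorm k (u : 'rV[R]_k) : R := Num.sqrt (dot u u).

Variables n m : nat.
Notation vspc := 'rV[R]_n.
Notation zspc := 'rV[R]_m.

(* [J_Z V] is [V *m J Z].  By the universal property of the Clifford algebra, a
   representation of [Cl(z,q)] is a linear map [J] from [z] to the endomorphisms
   with [J_Z ^ 2 = q(Z) id]. *)
Definition damek_ricci (J : {linear zspc -> 'M[R]_n}) : Prop :=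
  (forall Z : zspc, J Z *m J Z = (- dot Z Z)%:M) /\
  (forall (Z : zspc) (V : vspc), enorm (V *m J Z) = enorm Z * enorm V).

(* [(V, Z, t)]; as a tangent vector at [(0, 0, 1)] it is [V + Z + t A]. *)
Definition dr_space : normedModType R := (vspc * zspc * R)%type.

Definition half_space : set dr_space := [set p | 0 < p.2].

Variable J : {linear zspc -> 'M[R]_n}.

(* [<[U, V], Z> = <J_Z U, V>], read off on the standard basis of [z]. *)
Definition bracket (U V : vspc) : zspc :=
  \row_(i < m) dot (U *m J (delta_mx 0 i)) V.

Definition ltrans (p q : dr_space) : dr_space :=
  (p.1.1 + Num.sqrt p.2 *: q.1.1,
   p.1.2 + p.2 *: q.1.2 + (2^-1 * Num.sqrt p.2) *: bracket p.1.1 q.1.1,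
   p.2 * q.2).

Definition group_inv (p : dr_space) : dr_space :=
  (- ((Num.sqrt p.2)^-1 *: p.1.1), - (p.2^-1 *: p.1.2), p.2^-1).

Definition inner (X Y : dr_space) : R :=
  dot X.1.1 Y.1.1 + dot X.1.2 Y.1.2 + X.2 * Y.2.

Definition dr_metric (p X Y : dr_space) : R :=
  inner ('d (ltrans (group_inv p)) p X) ('d (ltrans (group_inv p)) p Y).

(* Unit vectors [(v, 0, s)] at the identity with [v != 0]. *)
Definition direction (v : vspc) (s : R) : Prop :=
  v != 0 /\ dot v v + s ^+ 2 = 1.

(* The focal variety of [eta = L_p o gamma], where the geodesic [gamma] starts
   at the identity with velocity [(v, 0, s)].  The curve [eta] determines [p]
   and [(v, 0, s)], so the variety is indexed by these. *)
Definition focal (p : dr_space) (v : vspc) (s : R) : set dr_space :=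
  [set q : dr_space | [/\ half_space q,
     bracket (q.1.1 - p.1.1) v = 0 &
     dot (q.1.1 - p.1.1) v = 2 * s * Num.sqrt p.2]].

End DamekRicci.

(* Main.v *)
Require Import Defs.
From HB Require Import structures.
From mathcomp Require Import all_boot all_order all_algebra.
From mathcomp Require Import all_classical all_reals all_analysis.
From mathcomp Require Import ring lra.
Import Order.TTheory GRing.Theory Num.Theory.
Import numFieldNormedType.Exports.

(** For V in v put K_V = RV + J_z V (cliff_span).  Both sides of the equivalence
    amount to the J2-condition, that J_X J_Y V lies in K_V for all V, X, Y.

    Focal varieties.  A focal variety with direction v through a point q is the
    set of points whose v-component differs from that of q by an element of the
    orthogonal complement of K_v (focalE), and v itself is the only datum left.
    Hence a geodesic through q is orthogonal to it exactly when its velocity,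
    translated back to the identity, is a vector of K_v (orthogonal_span).  The
    property of the theorem thus says that two spaces K_v with a common nonzero
    vector are equal.  The J2-condition implies this, because K_V is then stable
    under all J_Z and every nonzero u in K_V generates K_u = K_V (J2_focal).
    Conversely J_Y V lies in K_V and, when nonzero, is the initial velocity of an
    explicit geodesic, so K_V is the space of J_Y V and contains J_X J_Y V
    (focal_J2).

    From the J2-condition to symmetry.  Encode (V, Z, t) as V together with the
    operator q = tau + J_Z on v, where tau = t + |V|^2/4.  The geodesic symmetry at
    the identity is the inversion of Siegel-domain type, q to q^-1 and V to
    - q^-1 V.  It is an isometry because under the J2-condition the orthogonal
    projection onto K_V commutes with q and does not change when V is replaced by
    q^-1 V (inv_key, inv_isometry); left translations give the other points.

    From symmetry to the J2-condition.  Let f be an isometry fixing the identity e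
    with differential -1 there, and let B be its differential read in the
    left-invariant frame (frameop): an orthogonal operator at each point, equal to
    -1 at e.  In this frame the Levi-Civita connection has constant coefficients
    (nabla), and the naturality of the connection is a first-order equation for B
    (dframeopE).  Comparing the mixed second derivatives of B along a commuting
    pair V, Z shows that B preserves R(Z, V)V = - |V|^2/4 Z
    (frameop_curvature), and differentiating this at e, where B = -1, gives the
    vanishing of the covariant derivative of R on such vectors
    (curvature_parallel).  In the direction J_Y V, with X orthogonal to Y, this
    reads |V|^2 J_X J_Y V = J_C V with C = [V, J_X J_Y V], which puts J_X J_Y V in
    K_V (parallel_J2). *)

Set Implicit Arguments.
Unset Strict Implicit.
Unset Printing Implicit Defensive.

Local Open Scope ring_scope.
Local Open Scope classical_set_scope.

(** * Clifford modules and the J2-condition *)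

Section InnerProduct.
Context {R : realType} {k : nat}.
Implicit Types u v w : 'rV[R]_k.

Lemma dotC u v : dot u v = dot v u.
Proof. by apply: eq_bigr => i _; rewrite mulrC. Qed.

Lemma dotDl u v w : dot (u + v) w = dot u w + dot v w.
Proof. by rewrite /dot -big_split; apply: eq_bigr => i _; rewrite !mxE mulrDl. Qed.

Lemma dotZl c u w : dot (c *: u) w = c * dot u w.
Proof. by rewrite /dot mulr_sumr; apply: eq_bigr => i _; rewrite !mxE mulrA. Qed.

Lemma dotDr u v w : dot w (u + v) = dot w u + dot w v.
Proof. by rewrite dotC dotDl !(dotC w). Qed.

Lemma dotZr c u w : dot w (c *: u) = c * dot w u.
Proof. by rewrite dotC dotZl (dotC w). Qed.

Lemma dotNl u w : dot (- u) w = - dot u w.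
Proof. by rewrite -scaleN1r dotZl mulN1r. Qed.

Lemma dotNr u w : dot w (- u) = - dot w u.
Proof. by rewrite dotC dotNl (dotC w). Qed.

Lemma dot0l w : dot 0 w = 0.
Proof. by rewrite -(scale0r 0) dotZl mul0r. Qed.

Lemma dot0r w : dot w 0 = 0.
Proof. by rewrite dotC dot0l. Qed.

Definition dotE := (dotDl, dotDr, dotNl, dotNr, dotZl, dotZr, dot0l, dot0r).

Lemma dot_ge0 u : 0 <= dot u u.
Proof. by apply: sumr_ge0 => i _; rewrite -expr2 sqr_ge0. Qed.

Lemma dot_eq0 u : (dot u u == 0) = (u == 0).
Proof.
apply/eqP/eqP => [h|->]; last by rewrite dot0l.
have h0 (i : 'I_k) : true -> 0 <= u 0 i * u 0 i by rewrite -expr2 sqr_ge0.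
apply/rowP => i; rewrite mxE.
have hi : u 0 i * u 0 i = 0 by exact: (psumr_eq0P h0 h).
by move/eqP: hi; rewrite mulf_eq0 orbb => /eqP.
Qed.

Lemma dot_gt0 u : (0 < dot u u) = (u != 0).
Proof. by rewrite lt_def dot_ge0 andbT dot_eq0. Qed.

Lemma dot_delta u i : dot u (delta_mx 0 i) = u 0 i.
Proof.
rewrite /dot (bigD1 i) //= mxE !eqxx mulr1 big1 ?addr0 // => j ji.
by rewrite mxE (negbTE ji) andbF mulr0.
Qed.

(** Vector identities below are proved by pairing both sides with an arbitrary
    vector, which turns them into scalar identities for [ring], [field] or [lra]. *)
Lemma dot_inj u v : (forall w, dot u w = dot v w) -> u = v.
Proof. by move=> h; apply/rowP => i; rewrite -!dot_delta. Qed.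

Lemma enormE u v c : 0 <= c -> enorm u = c * enorm v -> dot u u = c ^+ 2 * dot v v.
Proof.
move=> c0 /(congr1 (fun x => x ^+ 2)).
by rewrite exprMn !sqr_sqrtr ?dot_ge0.
Qed.

End InnerProduct.

Section CliffordModule.
Context {R : realType} {n m : nat} (J : {linear 'rV[R]_m -> 'M[R]_n}).
Hypothesis hJ : damek_ricci J.
Implicit Types (U V w : 'rV[R]_n) (X Y Z : 'rV[R]_m).

Lemma Jsq Z V : V *m J Z *m J Z = - dot Z Z *: V.
Proof. by rewrite -mulmxA hJ.1 mul_mx_scalar. Qed.

(** Polarisation of the norm condition. *)
Lemma dot_JJ Z U V : dot (U *m J Z) (V *m J Z) = dot Z Z * dot U V.
Proof.
have q W : dot (W *m J Z) (W *m J Z) = dot Z Z * dot W W.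
  have /enormE := hJ.2 Z W; rewrite sqr_sqrtr ?dot_ge0// => -> //.
  by rewrite sqrtr_ge0.
have := q (U + V); rewrite mulmxDl !dotE !q (dotC V U) (dotC (V *m J Z)).
by lra.
Qed.

(** From J_Z^2 = - |Z|^2 and dot_JJ applied to U and J_Z V. *)
Lemma dot_J Z U V : dot (U *m J Z) V = - dot U (V *m J Z).
Proof.
have [->|Z0] := eqVneq Z 0; first by rewrite linear0 !mulmx0 !dotE oppr0.
have := dot_JJ Z U (V *m J Z); rewrite Jsq !dotE => h.
apply: (mulfI (_ : dot Z Z != 0)); first by rewrite dot_eq0.
by lra.
Qed.

Lemma dot_J_same Z V : dot (V *m J Z) V = 0.
Proof. by have := dot_J Z V V; rewrite (dotC V); lra. Qed.

Lemma JJ_anticomm X Y V :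
  V *m J X *m J Y + V *m J Y *m J X = - (2 * dot X Y) *: V.
Proof.
have := Jsq (X + Y) V.
rewrite linearD /= !(mulmxDr, mulmxDl) !Jsq !dotE (dotC Y X) => h.
by apply: dot_inj => w; have := congr1 (fun x => dot x w) h; rewrite /= !dotE; lra.
Qed.

(** The defining property of the bracket, extended from the standard basis to
    all of z by linearity. *)
Lemma dot_bracket U V Z : dot (bracket J U V) Z = dot (U *m J Z) V.
Proof.
rewrite [in RHS](row_sum_delta Z) linear_sum mulmx_sumr.
rewrite (big_morph (fun W => dot W V) (fun x y => dotDl x y V) (dot0l V)).
apply: eq_bigr => i _.
by rewrite mxE linearZ /= -scalemxAr dotZl mulrC.
Qed.

Lemma bracketDl U V w : bracket J (U + V) w = bracket J U w + bracket J V w.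
Proof. by apply: dot_inj => Z; rewrite !dotE !dot_bracket mulmxDl !dotE. Qed.

Lemma bracketZl c V w : bracket J (c *: V) w = c *: bracket J V w.
Proof. by apply: dot_inj => Z; rewrite !dotE !dot_bracket -scalemxAl !dotE. Qed.

Lemma bracketDr U V w : bracket J w (U + V) = bracket J w U + bracket J w V.
Proof. by apply: dot_inj => Z; rewrite !dotE !dot_bracket !dotE. Qed.

Lemma bracketZr c V w : bracket J w (c *: V) = c *: bracket J w V.
Proof. by apply: dot_inj => Z; rewrite !dotE !dot_bracket !dotE. Qed.

Lemma bracketC U V : bracket J U V = - bracket J V U.
Proof. by apply: dot_inj => Z; rewrite !dotE !dot_bracket dot_J dotC. Qed.

Lemma bracketNl V w : bracket J (- V) w = - bracket J V w.
Proof. by rewrite -scaleN1r bracketZl scaleN1r. Qed.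

Lemma bracketNr V w : bracket J w (- V) = - bracket J w V.
Proof. by rewrite -scaleN1r bracketZr scaleN1r. Qed.

Lemma bracket0l w : bracket J 0 w = 0.
Proof. by rewrite -(scale0r 0) bracketZl scale0r. Qed.

Lemma bracket0r w : bracket J w 0 = 0.
Proof. by rewrite -(scale0r 0) bracketZr scale0r. Qed.

Lemma bracketvv V : bracket J V V = 0.
Proof. by apply: dot_inj => Z; rewrite dot_bracket dot_J_same dot0l. Qed.

Definition bracketE := (bracketDl, bracketDr, bracketNl, bracketNr, bracketZl,
  bracketZr, bracket0l, bracket0r).

(** This makes Z the coordinate of J_Z V in K_V, up to the factor |V|^2. *)
Lemma bracket_J V Z : bracket J V (V *m J Z) = dot V V *: Z.
Proof.
apply: dot_inj => X; rewrite dot_bracket dotE.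
have := dot_JJ (X + Z) V V; rewrite [J (X + Z)]linearD mulmxDr !dotE !dot_JJ.
by rewrite (dotC (V *m J Z) (V *m J X)) ?(dotC Z X); lra.
Qed.

Lemma actDl U V Z : (U + V) *m J Z = U *m J Z + V *m J Z. Proof. exact: mulmxDl. Qed.
Lemma actNl U Z : (- U) *m J Z = - (U *m J Z). Proof. exact: mulNmx. Qed.
Lemma actZl c U Z : (c *: U) *m J Z = c *: (U *m J Z). Proof. by rewrite scalemxAl. Qed.
Lemma act0l Z : (0 : 'rV[R]_n) *m J Z = 0. Proof. exact: mul0mx. Qed.
Lemma actDr U X Y : U *m J (X + Y) = U *m J X + U *m J Y.
Proof. by rewrite linearD mulmxDr. Qed.
Lemma actNr U Z : U *m J (- Z) = - (U *m J Z). Proof. by rewrite linearN mulmxN. Qed.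
Lemma actZr c U Z : U *m J (c *: Z) = c *: (U *m J Z).
Proof. by rewrite linearZ scalemxAr. Qed.
Lemma act0r U : U *m J 0 = 0. Proof. by rewrite linear0 mulmx0. Qed.

Definition actE := (actDl, actNl, actZl, act0l, actDr, actNr, actZr, act0r).

(** The space K_V = RV + J_z V: the normal directions, at the identity, of a
    focal variety with direction V. *)
Definition cliff_span V w : Prop := exists c Z, w = c *: V + V *m J Z.

(** |V|^2 times the orthogonal projection onto K_V; leaving the factor in avoids
    the division and the case V = 0. *)
Definition cliff_proj V w := dot V w *: V + V *m J (bracket J V w).

Lemma cliff_proj_span V w : cliff_span V (cliff_proj V w).
Proof. by exists (dot V w), (bracket J V w). Qed.

Lemma dot_cliff_span V w c Z :
  dot (c *: V + V *m J Z) w = c * dot V w + dot (bracket J V w) Z.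
Proof. by rewrite !dotE dot_bracket. Qed.

Lemma cliff_spanD V w w' : cliff_span V w -> cliff_span V w' -> cliff_span V (w + w').
Proof.
move=> [c [Z ->]] [c' [Z' ->]]; exists (c + c'), (Z + Z').
by rewrite linearD mulmxDr scalerDl addrACA.
Qed.

Lemma cliff_spanZ V w a : cliff_span V w -> cliff_span V (a *: w).
Proof.
move=> [c [Z ->]]; exists (a * c), (a *: Z).
by rewrite linearZ -scalemxAr scalerDr scalerA.
Qed.

Lemma cliff_proj_orth V w k : cliff_span V k ->
  dot k (cliff_proj V w) = dot V V * dot k w.
Proof.
move=> [c [Z ->]]; rewrite /cliff_proj dotDr dotZr !dot_cliff_span bracketvv bracket_J.
by rewrite !dotE (dotC V (V *m _)) dot_J_same; ring.
Qed.

Lemma cliff_proj_uniq V w k : cliff_span V k ->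
  (forall k', cliff_span V k' -> dot k' k = dot V V * dot k' w) ->
  k = cliff_proj V w.
Proof.
move=> kV h; apply/eqP; rewrite -subr_eq0 -dot_eq0; set d := k - _.
have dV : cliff_span V d.
  by apply: cliff_spanD => //; rewrite -scaleN1r; apply: cliff_spanZ; exact: cliff_proj_span.
by rewrite {2}/d dotDr dotNr h // cliff_proj_orth // subrr.
Qed.

Lemma cliff_proj_id V k : cliff_span V k -> cliff_proj V k = dot V V *: k.
Proof.
move=> kV; symmetry; apply: cliff_proj_uniq => [|k' k'V]; first exact: cliff_spanZ.
by rewrite dotZr.
Qed.

Lemma orth_cliff_span V w : (forall k, cliff_span V k -> dot k w = 0) <->
   dot w V = 0 /\ bracket J w V = 0.
Proof.
split=> [h|[h1 h2] k [c [Z ->]]].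
  split; first by rewrite dotC; apply: h; exists 1, 0; rewrite linear0 mulmx0 scale1r addr0.
  apply: dot_inj => Z; rewrite dot0l bracketC dotNl dot_bracket h ?oppr0 //.
  by exists 0, Z; rewrite scale0r add0r.
by rewrite dot_cliff_span dotC h1 bracketC h2 oppr0 dot0l mulr0 addr0.
Qed.

(** K_V equals its double orthogonal complement, by subtracting the projection. *)
Lemma cliff_span_bidual V w : V != 0 ->
  (forall k, dot k V = 0 -> bracket J k V = 0 -> dot k w = 0) -> cliff_span V w.
Proof.
move=> V0 h; pose d := dot V V *: w - cliff_proj V w.
have dO k : cliff_span V k -> dot k d = 0.
  by move=> kV; rewrite dotDr dotNr dotZr cliff_proj_orth // subrr.
have [d1 d2] := (orth_cliff_span V d).1 dO.
have : dot d d = 0.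
  rewrite {2}/d dotDr dotNr dotZr h // dotC dotC mulr0 sub0r (dotC d) dO ?oppr0//.
  exact: cliff_proj_span.
move/eqP; rewrite dot_eq0 subr_eq0 => /eqP e.
have -> : w = (dot V V)^-1 *: cliff_proj V w.
  by rewrite -e scalerA mulVf ?scale1r // dot_eq0.
by apply: cliff_spanZ; exact: cliff_proj_span.
Qed.

Lemma cliff_span_refl V : cliff_span V V.
Proof. by exists 1, 0; rewrite linear0 mulmx0 scale1r addr0. Qed.

Lemma cliff_spanJ V Z : cliff_span V (V *m J Z).
Proof. by exists 0, Z; rewrite scale0r add0r. Qed.

(** The J2-condition of Cowling, Dooley, Koranyi and Ricci.  For X = Y the vector
    is a multiple of V by the Clifford relation, so only orthogonal X, Y matter. *)
Definition J2_condition := forall V X Y, cliff_span V (V *m J Y *m J X).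

Section J2.
Hypothesis h2 : J2_condition.

Lemma cliff_span_act V w Z : cliff_span V w -> cliff_span V (w *m J Z).
Proof.
move=> [c [X ->]]; rewrite mulmxDl -scalemxAl; apply: cliff_spanD; last exact: h2.
by apply: cliff_spanZ; exact: cliff_spanJ.
Qed.

Lemma cliff_span_trans U V w : cliff_span V U -> cliff_span U w -> cliff_span V w.
Proof.
move=> UV [c [Z ->]]; apply: cliff_spanD; first exact: cliff_spanZ.
exact: cliff_span_act.
Qed.

(** If U = (c + J_Z) V then V = (c - J_Z) U / (c^2 + |Z|^2). *)
Lemma cliff_span_sym U V : U != 0 -> cliff_span V U -> cliff_span U V.
Proof.
move=> U0 [c [Z e]].
have V0 : V != 0 by apply: contra_neq U0 => V0; rewrite e V0 scaler0 mul0mx addr0.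
have h : (c ^+ 2 + dot Z Z) *: V = c *: U + U *m J (- Z).
  rewrite e linearN mulmxN scalerDr !mulmxDl -scalemxAl Jsq scalerA.
  by apply: dot_inj => w; rewrite !dotE; ring.
have a0 : c ^+ 2 + dot Z Z != 0.
  apply: contra_neq U0 => a0.
  have /eqP Z0 : dot Z Z == 0 by have := dot_ge0 Z; have := sqr_ge0 c; lra.
  have c0 : c = 0 by apply/eqP; rewrite -sqrf_eq0; apply/eqP; lra.
  move/eqP: Z0; rewrite dot_eq0 => /eqP Z0.
  by rewrite e Z0 c0 linear0 mulmx0 scale0r addr0.
rewrite -(scale1r V) -(mulVf a0) -scalerA h.
by apply: cliff_spanZ; exists c, (- Z).
Qed.

Lemma cliff_proj_change U V w : U != 0 -> cliff_span V U ->
  dot V V *: cliff_proj U w = dot U U *: cliff_proj V w.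
Proof.
move=> U0 UV; have VU := cliff_span_sym U0 UV.
have V0 : V != 0.
  by apply: contra_neq U0 => V0; case: UV => c [Z ->]; rewrite V0 scaler0 mul0mx addr0.
apply: (scalerI (_ : (dot V V)^-1 != 0)); first by rewrite invr_neq0 // dot_eq0.
rewrite scalerA mulVf ?scale1r ?dot_eq0 //; symmetry; apply: cliff_proj_uniq.
  do 2!apply: cliff_spanZ; exact: cliff_span_trans VU (cliff_proj_span _ _).
move=> k kU; rewrite !dotZr cliff_proj_orth; last exact: cliff_span_trans UV kU.
by field; rewrite dot_eq0.
Qed.

Lemma cliff_proj_act V Z w : V != 0 -> cliff_proj V (w *m J Z) = cliff_proj V w *m J Z.
Proof.
move=> V0; symmetry; apply: cliff_proj_uniq.
  by apply: cliff_span_act; exact: cliff_proj_span.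
move=> k kV; rewrite dotC dot_J dotC cliff_proj_orth; last exact: cliff_span_act.
by rewrite dot_J mulrN opprK (dotC k).
Qed.

End J2.
End CliffordModule.

(** * Directional derivatives *)

Section DirectionalCalculus.
Context {R : realType}.
Implicit Types E F G : normedModType R.

(** Differentiability together with the value of one directional derivative: in
    this form the differentiation rules compose without side conditions. *)
Definition der E F (f : E -> F) (p X : E) (L : F) : Prop :=
  differentiable f p /\ 'D_X f p = L.

Lemma der_diff E F (f : E -> F) p X L : der f p X L -> 'd f p X = L.
Proof. by move=> [df <-]; rewrite deriveE. Qed.

Lemma der_derive E F (f : E -> F) p X : differentiable f p -> der f p X ('D_X f p).
Proof. by []. Qed.

Lemma der_eq E F (f : E -> F) p X L L' : der f p X L -> L = L' -> der f p X L'.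
Proof. by move=> h <-. Qed.

Lemma der_cst E F (a : F) (p X : E) : der (fun=> a) p X 0.
Proof. by split; [exact: differentiable_cst | rewrite derive_cst]. Qed.

Lemma der_id E (p X : E) : der (fun q => q) p X X.
Proof. by split; [exact: (@ex_diff _ _ _ _ _ _ id) | exact: derive_id]. Qed.

Lemma derD E F (f g : E -> F) p X L M :
  der f p X L -> der g p X M -> der (fun q => f q + g q) p X (L + M).
Proof.
move=> [df <-] [dg <-]; split; first exact: differentiableD.
by apply: deriveD; exact: diff_derivable.
Qed.

Lemma der_sum E F (I : Type) (r : seq I) (f : I -> E -> F) p X (L : I -> F) :
  (forall i, der (f i) p X (L i)) ->
  der (fun q => \sum_(i <- r) f i q) p X (\sum_(i <- r) L i).
Proof.
move=> h; elim: r => [|i r IH].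
  rewrite big_nil; under eq_fun do rewrite big_nil; exact: der_cst.
rewrite big_cons; under eq_fun do rewrite big_cons; exact: derD.
Qed.

Lemma der_lin E F G (l : {linear F -> G}) (f : E -> F) p X L :
  continuous l -> der f p X L -> der (fun q => l (f q)) p X (l L).
Proof.
move=> lc [df <-]; have dl : differentiable l (f p) by exact: linear_differentiable.
split; first exact: differentiable_comp.
rewrite deriveE; last exact: differentiable_comp.
by rewrite -[fun q => _]/(l \o f) (diff_comp df dl) /= diff_lin // deriveE.
Qed.

Lemma der_comp E F G (g : F -> G) (f : E -> F) p X L M :
  der f p X L -> der g (f p) L M -> der (fun q => g (f q)) p X M.
Proof.
move=> [df <-] [dg <-]; split; first exact: differentiable_comp.
rewrite deriveE; last exact: differentiable_comp.
by rewrite -[fun q => _]/(g \o f) (diff_comp df dg) /= !deriveE.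
Qed.

Lemma scale_bilinear F :
  bilinear_for (GRing.Scale.Law.clone _ _ *:%R _) (GRing.Scale.Law.clone _ _ *:%R _)
    (@GRing.scale R F).
Proof.
split=> [u'|u] a x y /=; first by rewrite scalerDl scalerA.
by rewrite scalerDr !scalerA mulrC.
Qed.

HB.instance Definition _ F :=
  bilinear_isBilinear.Build R R F F _ _ (@GRing.scale R F) (@scale_bilinear F).

Lemma derZ E F (h : E -> R) (f : E -> F) p X a L : der h p X a -> der f p X L ->
  der (fun q => h q *: f q) p X (a *: f p + h p *: L).
Proof.
move=> [dh <-] [df <-].
have sc : continuous (fun q : R * F => q.1 *: q.2) by move=> [a0 x]; exact: scale_continuous.
have ds : differentiable (fun q : R * F => q.1 *: q.2) (h p, f p).
  exact: (differentiable_bilin _ sc).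
have dp : differentiable (fun q => (h q, f q)) p by exact: differentiable_pair.
split; first exact: (differentiable_comp dp ds).
rewrite deriveE; last exact: (differentiable_comp dp ds).
rewrite -[fun q => _]/((fun q : R * F => q.1 *: q.2) \o (fun q => (h q, f q))).
by rewrite (diff_comp dp ds) /= (diff_bilin _ sc) diff_pair //= !deriveE // addrC.
Qed.

Lemma derM E (h f : E -> R) p X a L : der h p X a -> der f p X L ->
  der (fun q => h q * f q) p X (a * f p + h p * L).
Proof. exact: derZ. Qed.

Lemma derN E F (f : E -> F) p X L : der f p X L -> der (fun q => - f q) p X (- L).
Proof.
move=> [df <-]; split; first exact: differentiableN.
by apply: deriveN; exact: diff_derivable.
Qed.

Lemma derB E F (f g : E -> F) p X L M :
  der f p X L -> der g p X M -> der (fun q => f q - g q) p X (L - M).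
Proof. by move=> h1 h2; apply: derD => //; exact: derN. Qed.

Lemma derV E (h : E -> R) p X a : h p != 0 -> der h p X a ->
  der (fun q => (h q)^-1) p X (- (h p) ^- 2 * a).
Proof.
move=> h0 [dh <-]; split; first exact: differentiableV.
by rewrite deriveV //; exact: diff_derivable.
Qed.

Lemma der_R (h : R -> R) (x a b : R) : is_derive x (1 : R) h a -> der h x b (b * a).
Proof.
move=> [dh <-]; have dh' : differentiable h x by apply/derivable1_diffP.
split=> //; rewrite !deriveE //.
by rewrite -[in LHS](mulr1 b) -[b * 1]/(b *: 1) linearZ.
Qed.

Lemma der_sqrt E (h : E -> R) p X a : 0 < h p -> der h p X a ->
  der (fun q => Num.sqrt (h q)) p X (a * (2 * Num.sqrt (h p))^-1).
Proof.
by move=> h0 dh; apply: (der_comp dh); apply: der_R; exact: is_derive1_sqrt.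
Qed.

Lemma der_pair E F G (f : E -> F) (g : E -> G) p X L M :
  der f p X L -> der g p X M -> der (fun q => (f q, g q)) p X (L, M).
Proof.
move=> [df <-] [dg <-]; split; first exact: differentiable_pair.
rewrite deriveE; last exact: differentiable_pair.
by rewrite diff_pair //= !deriveE.
Qed.

Lemma fst_linear_continuous F G : continuous (fst : F * G -> F).
Proof. by move=> x; exact: cvg_fst. Qed.

Lemma snd_linear_continuous F G : continuous (snd : F * G -> G).
Proof. by move=> x; exact: cvg_snd. Qed.

Lemma der_fst E F G (f : E -> (F * G)%type) p X L :
  der f p X L -> der (fun q => (f q).1) p X L.1.
Proof. by move=> h; apply: (@der_lin _ _ _ fst) h; exact: fst_linear_continuous. Qed.

Lemma der_snd E F G (f : E -> (F * G)%type) p X L :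
  der f p X L -> der (fun q => (f q).2) p X L.2.
Proof. by move=> h; apply: (@der_lin _ _ _ snd) h; exact: snd_linear_continuous. Qed.

(** A function vanishing near p is differentiable there; this transfers
    derivatives between functions that agree only on an open set. *)
Lemma der_near0 E F (e : E -> F) p X : (\near p, e p = 0) -> der e p X 0.
Proof.
move=> e0.
have ep : e p = 0 := nbhs_singleton e0.
have c0 : continuous (0 : E -> F) by move=> ?; exact: cvg_cst.
have de : e \o shift p = cst (e p) + (\0 : {linear E -> F}) +o_ (0 : E) id.
  apply/eqaddoP => eps eps0.
  have : \forall h \near (0 : E), e (shift p h) = 0.
    have sh : h + p @[h --> (0 : E)] --> p.
      by rewrite -{2}(add0r p); apply: cvgD; [exact: cvg_id | exact: cvg_cst].
    exact: (sh _ e0).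
  apply: filterS => h eh.
  by rewrite /= !fctE /= eh ep addr0 subrr normr0 mulr_ge0 // ltW.
have d0 := @diff_unique _ _ _ e (\0 : {linear E -> F}) p c0 de.
have df : differentiable e p.
  by apply/diff_locallyP; rewrite d0.
by split=> //; rewrite deriveE // d0.
Qed.

Lemma der_near E F (f g : E -> F) p X L :
  (\near p, f p = g p) -> der f p X L -> der g p X L.
Proof.
move=> fg df; have e0 : \near p, g p - f p = 0.
  by apply: filterS fg => q ->; rewrite subrr.
have := derD df (der_near0 X e0); rewrite addr0.
by under eq_fun do rewrite addrC subrK.
Qed.

End DirectionalCalculus.

(** * Higher differentiability and mixed derivatives *)

Section HigherDifferentiability.
Context {R : realType} {E : normedModType R} (S : set E).
Hypothesis oS : open S.
Implicit Types F G : normedModType R.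

(** [Ck] with an arbitrary codomain, as needed to build maps from coordinates. *)
Fixpoint Cn F (k : nat) (f : E -> F) : Prop :=
  if k is k'.+1 then
    (forall p, S p -> differentiable f p) /\
    (forall X : E, Cn k' (fun p => 'D_X f p))
  else forall p, S p -> {for p, continuous f}.

Lemma Ck_Cn k (f : E -> E) : Ck S k f <-> Cn k f.
Proof.
elim: k f => [//|k IH] f /=; split=> -[df h]; split=> // X; exact/IH.
Qed.

Lemma near_open (P : E -> Prop) p : S p -> (forall q, S q -> P q) -> \near p, P p.
Proof. by move=> Sp h; apply: filterS (open_nbhs_nbhs (conj oS Sp)). Qed.

Lemma CnS F k (f : E -> F) : Cn k.+1 f -> Cn k f.
Proof.
elim: k f => [|k IH] f [df h]; first by move=> p /df; exact: differentiable_continuous.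
by split=> // X; apply: IH.
Qed.

Lemma Cn_ext F k (f g : E -> F) : (forall p, S p -> f p = g p) -> Cn k f -> Cn k g.
Proof.
elim: k f g => [|k IH] f g fg.
  move=> cf p Sp; have e := near_open Sp fg.
  rewrite /prop_for /continuous_at -fg //; apply: cvg_trans (cf p Sp).
  by apply: near_eq_cvg.
move=> [df h]; split.
  by move=> p Sp; have [] := der_near (near_open Sp fg) (der_derive 0 (df p Sp)).
move=> X; apply: IH (h X) => p Sp.
by have [_ ->] := der_near (near_open Sp fg) (der_derive X (df p Sp)).
Qed.

(** Every closure property of the class C^k below is an induction on k, in which
    this lemma reduces k.+1 to k through a formula for the derivative. *)
Lemma CnS_der F k (f : E -> F) (f' : E -> E -> F) :
  (forall p X, S p -> der f p X (f' X p)) -> (forall X, Cn k (f' X)) -> Cn k.+1 f.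
Proof.
move=> h hk; split=> [p Sp|X]; first by have [] := h p 0 Sp.
by apply: Cn_ext (hk X) => p Sp; have [_ ->] := h p X Sp.
Qed.

Lemma Cn_der F k (f : E -> F) p X : S p -> Cn k.+1 f -> der f p X ('D_X f p).
Proof. by move=> Sp [df _]; split=> //; exact: df. Qed.

Lemma Cn_D F k (f : E -> F) X : Cn k.+1 f -> Cn k (fun p => 'D_X f p).
Proof. by move=> [_ h]; exact: h. Qed.

Lemma Cn_cst F k (a : F) : Cn k (fun=> a).
Proof.
elim: k F a => [|k IH] F a; first by move=> p _; exact: cvg_cst.
by apply: CnS_der => [p X _|X]; [exact: der_cst | exact: IH].
Qed.

Lemma Cn_id k : Cn k (fun q : E => q).
Proof.
case: k => [|k]; first by move=> p _; exact: cvg_id.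
by apply: CnS_der => [p X _|X]; [exact: der_id | exact: Cn_cst].
Qed.

Lemma CnD F k (f g : E -> F) : Cn k f -> Cn k g -> Cn k (fun q => f q + g q).
Proof.
elim: k f g => [|k IH] f g; first by move=> cf cg p Sp; apply: cvgD; [exact: cf | exact: cg].
move=> hf hg; apply: CnS_der => [p X Sp|X]; first exact: derD (Cn_der X Sp hf) (Cn_der X Sp hg).
exact: IH (Cn_D X hf) (Cn_D X hg).
Qed.

Lemma Cn_sum F k (I : Type) (r : seq I) (f : I -> E -> F) :
  (forall i, Cn k (f i)) -> Cn k (fun q => \sum_(i <- r) f i q).
Proof.
move=> h; elim: r => [|i r IH].
  by under eq_fun do rewrite big_nil; exact: Cn_cst.
by under eq_fun do rewrite big_cons; exact: CnD.
Qed.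

Lemma Cn_lin F G k (l : {linear F -> G}) (f : E -> F) :
  continuous l -> Cn k f -> Cn k (fun q => l (f q)).
Proof.
move=> lc; elim: k f => [|k IH] f.
  by move=> cf p Sp; apply: continuous_comp; [exact: cf | exact: lc].
move=> hf; apply: CnS_der => [p X Sp|X]; first exact: der_lin lc (Cn_der X Sp hf).
exact: IH (Cn_D X hf).
Qed.

Lemma CnN F k (f : E -> F) : Cn k f -> Cn k (fun q => - f q).
Proof.
elim: k f => [|k IH] f; first by move=> cf p Sp; apply: cvgN; exact: cf.
move=> hf; apply: CnS_der => [p X Sp|X]; first exact: derN (Cn_der X Sp hf).
exact: IH (Cn_D X hf).
Qed.

Lemma CnB F k (f g : E -> F) : Cn k f -> Cn k g -> Cn k (fun q => f q - g q).
Proof. by move=> hf hg; apply: CnD => //; exact: CnN. Qed.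

Lemma CnZ F k (h : E -> R) (f : E -> F) :
  Cn k h -> Cn k f -> Cn k (fun q => h q *: f q).
Proof.
elim: k h f => [|k IH] h f.
  by move=> ch cf p Sp; apply: cvgZ; [exact: ch | exact: cf].
move=> hh hf; apply: CnS_der => [p X Sp|X].
  exact: derZ (Cn_der X Sp hh) (Cn_der X Sp hf).
by apply: CnD; apply: IH; [exact: Cn_D|exact: CnS|exact: CnS|exact: Cn_D].
Qed.

Lemma CnM k (h f : E -> R) : Cn k h -> Cn k f -> Cn k (fun q => h q * f q).
Proof. exact: CnZ. Qed.

Lemma CnV k (h : E -> R) : (forall p, S p -> h p != 0) -> Cn k h -> Cn k (fun q => (h q)^-1).
Proof.
move=> h0; elim: k => [|k IH] hh; first by move=> p Sp; apply: cvgV; [exact: h0|exact: hh].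
apply: CnS_der => [p X Sp|X]; first exact: derV (h0 _ Sp) (Cn_der X Sp hh).
have iV := IH (CnS hh).
apply: CnM (Cn_D X hh); apply: CnN.
by apply: (@Cn_ext _ _ (fun q => (h q)^-1 * (h q)^-1)); [move=> p _; rewrite -invfM -expr2|exact: CnM].
Qed.

Lemma Cn_sqrt k (h : E -> R) : (forall p, S p -> 0 < h p) -> Cn k h ->
  Cn k (fun q => Num.sqrt (h q)).
Proof.
move=> h0; elim: k => [|k IH] hh.
  by move=> p Sp; apply: continuous_comp; [exact: hh|exact: sqrt_continuous].
apply: CnS_der => [p X Sp|X]; first exact: der_sqrt (h0 _ Sp) (Cn_der X Sp hh).
apply: CnM (Cn_D X hh) _; apply: CnV => [p Sp|]; first by rewrite mulf_neq0 // gt_eqF // sqrtr_gt0 h0.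
by apply: CnM; [exact: Cn_cst|exact: IH (CnS hh)].
Qed.

Lemma Cn_pair F G k (f : E -> F) (g : E -> G) :
  Cn k f -> Cn k g -> Cn k (fun q => (f q, g q)).
Proof.
elim: k f g => [|k IH] f g; first by move=> cf cg p Sp; apply: cvg_pair; [exact: cf|exact: cg].
move=> hf hg; apply: CnS_der => [p X Sp|X]; first exact: der_pair (Cn_der X Sp hf) (Cn_der X Sp hg).
exact: IH (Cn_D X hf) (Cn_D X hg).
Qed.

Lemma Cn_fst F G k (f : E -> (F * G)%type) : Cn k f -> Cn k (fun q => (f q).1).
Proof. by move=> hf; apply: (@Cn_lin _ _ _ fst) hf; exact: fst_linear_continuous. Qed.

Lemma Cn_snd F G k (f : E -> (F * G)%type) : Cn k f -> Cn k (fun q => (f q).2).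
Proof. by move=> hf; apply: (@Cn_lin _ _ _ snd) hf; exact: snd_linear_continuous. Qed.

(** Two applications of the mean value theorem to the second difference over a
    square, first along X and then along Y. *)
Lemma second_difference (f : E -> R) p X Y (h : R) : 0 < h -> Cn 2 f ->
  (forall a b : R, 0 <= a <= h -> 0 <= b <= h -> S (p + a *: X + b *: Y)) ->
  exists a b : R, [/\ 0 <= a <= h, 0 <= b <= h &
    f (p + h *: X + h *: Y) - f (p + h *: X) - (f (p + h *: Y) - f p) =
    'D_Y (fun q => 'D_X f q) (p + a *: X + b *: Y) * h * h].
Proof.
move=> h0 hf sq.
have S0 (a : R) : 0 <= a <= h -> S (p + a *: X).
  by move=> ha; have := sq a 0 ha; rewrite scale0r addr0; apply; rewrite lexx ltW.
have hh : 0 <= h <= h by rewrite lexx ltW.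
have dline (g : E -> R) q Z a L : der g (q + a *: Z) Z L ->
    der (fun t : R => g (q + t *: Z)) a (1 : R) L.
  move=> hg; refine (der_comp (f := fun t : R => q + t *: Z) _ hg).
  rewrite -[X in der _ _ _ X]add0r; apply: derD; first exact: der_cst.
  by apply: der_eq (derZ (der_id _ _) (der_cst _ _ _)) _; rewrite scaler0 addr0 scale1r.
pose phi (a : R) := f (p + h *: Y + a *: X) - f (p + a *: X).
have dphi (a : R) : 0 <= a <= h -> der phi a (1 : R)
   ('D_X f (p + h *: Y + a *: X) - 'D_X f (p + a *: X)).
  move=> ha; apply: derB; apply: dline; apply: (Cn_der X _ hf); last exact: S0.
  by rewrite addrAC; exact: sq.
have [|x|a /[!in_itv] /= /andP[a0 ah] ea] := MVT (f := phi)
  (df := fun a => 'D_X f (p + h *: Y + a *: X) - 'D_X f (p + a *: X)) h0.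
- move=> x; rewrite in_itv /= => /andP[x0 xh].
  have [dx <-] := dphi x (introT andP (conj (ltW x0) (ltW xh))).
  by apply: DeriveDef => //; exact: diff_derivable.
- apply: continuous_in_subspaceT => y; rewrite inE /= in_itv /= => hy.
  by have [/differentiable_continuous] := dphi y hy.
have ha : 0 <= a <= h by rewrite !ltW.
pose psi (b : R) := 'D_X f (p + a *: X + b *: Y).
have dpsi (b : R) : 0 <= b <= h -> der psi b (1 : R) ('D_Y (fun q => 'D_X f q) (p + a *: X + b *: Y)).
  move=> hb; apply: (dline (fun q => 'D_X f q)).
  by apply: (Cn_der Y _ (Cn_D X hf)); exact: sq.
have [|x|b /[!in_itv] /= /andP[b0 bh] eb] := MVT (f := psi)
  (df := fun b => 'D_Y (fun q => 'D_X f q) (p + a *: X + b *: Y)) h0.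
- move=> x; rewrite in_itv /= => /andP[x0 xh].
  have [dx <-] := dpsi x (introT andP (conj (ltW x0) (ltW xh))).
  by apply: DeriveDef => //; exact: diff_derivable.
- apply: continuous_in_subspaceT => y; rewrite inE /= in_itv /= => hy.
  by have [/differentiable_continuous] := dpsi y hy.
exists a, b; split; rewrite ?ltW //.
move: ea eb; rewrite /phi /psi !scale0r !addr0 !subr0 => ea eb.
by rewrite -eb [p + a *: X + _]addrAC -ea [p + h *: X + _]addrAC.
Qed.

(** The second difference is symmetric in X and Y, so second_difference in both
    orders evaluates both mixed derivatives at points close to p. *)
Lemma Schwarz (f : E -> R) p X Y : S p -> Cn 2 f ->
  'D_Y (fun q => 'D_X f q) p = 'D_X (fun q => 'D_Y f q) p.
Proof.
move=> Sp hf; apply/eqP; rewrite -subr_eq0 -normr_le0; apply/ler_addgt0Pl => eps e0.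
rewrite addr0.
have c1 : {for p, continuous (fun q => 'D_Y (fun q => 'D_X f q) q)}.
  exact: (Cn_D Y (Cn_D X hf)).
have c2 : {for p, continuous (fun q => 'D_X (fun q => 'D_Y f q) q)}.
  exact: (Cn_D X (Cn_D Y hf)).
have e2 : 0 < eps / 2 by rewrite divr_gt0.
have n1 : \forall q \near p, `|'D_Y (fun q => 'D_X f q) p - 'D_Y (fun r => 'D_X f r) q| <= eps / 2.
  exact: ((cvgrPdist_le _ _).1 c1).
have n2 : \forall q \near p, `|'D_X (fun q => 'D_Y f q) p - 'D_X (fun r => 'D_Y f r) q| <= eps / 2.
  exact: ((cvgrPdist_le _ _).1 c2).
have nS := open_nbhs_nbhs (conj oS Sp).
have nb : nbhs p (S `&`
  ([set q | `|'D_Y (fun r => 'D_X f r) p - 'D_Y (fun r => 'D_X f r) q| <= eps / 2] `&`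
   [set q | `|'D_X (fun r => 'D_Y f r) p - 'D_X (fun r => 'D_Y f r) q| <= eps / 2])).
  by apply: filterI nS _; apply: filterI n1 _.
have [r /= r0 hr] := (nbhs_ballP _ _).1 nb.
(* The side h is chosen so that the whole square lies in the ball; adding 1 to M
   covers X = Y = 0. *)
pose M := `|X| + `|Y| + 1.
have M0 : 0 < M by rewrite ltr_wpDl // addr_ge0.
pose h := r / 2 / M.
have h0 : 0 < h by rewrite !divr_gt0.
have inb (a b : R) : 0 <= a <= h -> 0 <= b <= h -> ball p r (p + a *: X + b *: Y).
  move=> /andP[a0 ah] /andP[b0 bh].
  rewrite -ball_normE /= -addrA opprD addNKr normrN.
  apply: le_lt_trans (ler_normD _ _) _; rewrite !normrZ !ger0_norm //.
  apply: (@le_lt_trans _ _ (h * M)); last by rewrite divfK ?gt_eqF // ltr_pdivrMr // ltr_pMr // ltr1n.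
  by rewrite /M !mulrDr mulr1 ler_wpDr ?(ltW h0) // lerD // ler_wpM2r.
have [a [b [ha hb e1]]] := second_difference h0 hf (fun a b ha hb => (hr _ (inb a b ha hb)).1).
have inb' (a1 b1 : R) : 0 <= a1 <= h -> 0 <= b1 <= h -> ball p r (p + a1 *: Y + b1 *: X).
  by move=> ??; rewrite addrAC; exact: inb.
have [c [d [hc hd e3]]] := second_difference h0 hf (fun a b ha hb => (hr _ (inb' a b ha hb)).1).
have ee : 'D_Y (fun q => 'D_X f q) (p + a *: X + b *: Y) =
    'D_X (fun q => 'D_Y f q) (p + c *: Y + d *: X).
  have hn0 : h != 0 by rewrite gt_eqF.
  apply: (mulIf hn0); apply: (mulIf hn0).
  apply: etrans (esym e1) _; apply: etrans _ e3; rewrite [p + h *: Y + _]addrAC.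
  by move: (f _) (f _) (f _) (f _) => x1 x2 x3 x4; ring.
have := (hr _ (inb a b ha hb)).2.1; have := (hr _ (inb' _ _ hc hd)).2.2.
rewrite /= -ee.
move: ('D_Y _ p) ('D_X _ p) ('D_Y _ _) => u v w A B.
apply: le_trans (ler_distD w u v) _; rewrite (splitr eps).
by apply: lerD; [exact: B | rewrite distrC; exact: A].
Qed.

End HigherDifferentiability.

(** * Coordinates on the half-space *)

Section Coordinates.
Context {R : realType} {n m : nat}.
Notation E := (dr_space R n m).

Definition dr_basis (i : 'I_n + 'I_m + unit) : E :=
  match i with
  | inl (inl j) => (delta_mx 0 j, 0, 0)
  | inl (inr j) => (0, delta_mx 0 j, 0)
  | inr _ => (0, 0, 1)
  end.

Definition dr_coord (i : 'I_n + 'I_m + unit) (x : E) : R :=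
  match i with
  | inl (inl j) => x.1.1 0 j
  | inl (inr j) => x.1.2 0 j
  | inr _ => x.2
  end.

Lemma dr_eq (x y : E) : x.1.1 = y.1.1 -> x.1.2 = y.1.2 -> x.2 = y.2 -> x = y.
Proof. by case: x y => [[a b] c] [[a' b'] c'] /= -> -> ->. Qed.

Lemma dr_sum (I : Type) (r : seq I) (F : I -> E) :
  \sum_(i <- r) F i =
  (\sum_(i <- r) (F i).1.1, \sum_(i <- r) (F i).1.2, \sum_(i <- r) (F i).2).
Proof. by elim: r => [|i r IH]; rewrite ?big_nil // !big_cons IH. Qed.

Lemma dr_coord_basis (x : E) : x = \sum_i dr_coord i x *: dr_basis i.
Proof.
rewrite !big_sumType /= [X in _ + X](big_pred1 tt) => [|[]] //.
rewrite !dr_sum /=; apply: dr_eq => /=.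
- rewrite [X in _ + X + _]big1 => [|i _]; last by rewrite scaler0.
  by rewrite scaler0 !addr0 -row_sum_delta.
- rewrite big1 => [|i _]; last by rewrite scaler0.
  by rewrite scaler0 add0r addr0 -row_sum_delta.
- by rewrite !big1 => [|i _|i _]; rewrite ?scaler0 // !add0r [_ *: _]mulr1.
Qed.

Lemma dr_coord_is_linear i : linear (dr_coord i).
Proof. by case: i => [[j|j]|j] a x y /=; rewrite ?mxE. Qed.

HB.instance Definition _ i := GRing.isLinear.Build _ _ _ _ _ (@dr_coord_is_linear i).

Lemma dr_coord_continuous i : continuous (dr_coord i).
Proof.
case: i => [[j|j]|j] x.
- apply: (continuous_comp (f := fun y : E => y.1.1) (g := fun M => M 0 j)).
    by apply: (continuous_comp (f := fst) (g := fst)); apply: fst_linear_continuous.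
  exact: coord_continuous.
- apply: (continuous_comp (f := fun y : E => y.1.2) (g := fun M => M 0 j)).
    apply: (continuous_comp (f := fst) (g := snd)); first exact: fst_linear_continuous.
    exact: snd_linear_continuous.
  exact: coord_continuous.
- exact: snd_linear_continuous.
Qed.

Lemma linear_coord (F : lmodType R) (f : E -> F) x :
  linear f -> f x = \sum_i dr_coord i x *: f (dr_basis i).
Proof.
move=> lf; pose fM := GRing.isLinear.Build _ _ _ _ _ lf.
pose fL : {linear _ -> _} := HB.pack f fM.
rewrite {1}(dr_coord_basis x) -[f]/(fL : _ -> _) linear_sum.
by apply: eq_bigr => i _; rewrite linearZ.
Qed.

Lemma dr_coord_inj x y : (forall i, dr_coord i x = dr_coord i y) -> x = y.
Proof.
by move=> h; rewrite [x]dr_coord_basis [y]dr_coord_basis; apply: eq_bigr => i _; rewrite h.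
Qed.

(** Leibniz rule for an operator A q applied to a vector u q, both depending on q:
    only the derivatives of A at fixed vectors are required, since A q (u q) is
    the combination of the A q b, b in the basis, with the coordinates of u q. *)
Lemma der_apply (E0 F : normedModType R) (A : E0 -> E -> F) (A' : E -> F) (u : E0 -> E) p X L :
  (forall q, linear (A q)) -> (forall x, der (A^~ x) p X (A' x)) -> der u p X L ->
  der (fun q => A q (u q)) p X (A' (u p) + A p L).
Proof.
move=> lA dA du.
have e v : (fun q => A q (v q)) = (fun q => \sum_i dr_coord i (v q) *: A q (dr_basis i)).
  by apply/funext => q; exact: linear_coord.
have h v M : der v p X M -> der (fun q => A q (v q)) p X
    (\sum_i (dr_coord i M *: A p (dr_basis i) + dr_coord i (v p) *: A' (dr_basis i))).
  move=> dv; rewrite e; apply: der_sum => i; apply: derZ (dA _).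
  exact: (der_lin (@dr_coord_continuous i)).
apply: der_eq (h _ _ du) _; rewrite big_split /= -linear_coord // addrC; congr (_ + _).
have [_ <-] := dA (u p); have [_ ->] := h _ _ (der_cst (u p) p X).
by rewrite big_split /= [X in _ = X + _]big1 ?add0r // => i _; rewrite linear0 scale0r.
Qed.

Lemma der_linear (E0 F : normedModType R) (l : E -> F) (u : E0 -> E) p X L :
  linear l -> der u p X L -> der (fun q => l (u q)) p X (l L).
Proof.
move=> ll du.
have := @der_apply _ _ (fun _ => l) (fun=> 0) u p X L (fun _ => ll) (fun x => der_cst _ _ _) du.
by rewrite add0r.
Qed.

Lemma der_bilin (E0 F : normedModType R) (b : E -> E -> F) (u v : E0 -> E) p X L M :
  (forall x, linear (b x)) -> (forall y, linear (b^~ y)) ->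
  der u p X L -> der v p X M ->
  der (fun q => b (u q) (v q)) p X (b L (v p) + b (u p) M).
Proof.
move=> lr ll du dv.
apply: (@der_apply _ _ (fun q => b (u q)) (b L) v) => // x.
exact: (der_linear (ll x)).
Qed.

Variable S : set E.
Hypothesis oS : open S.

Lemma Cn_apply (F : normedModType R) k (A : E -> E -> F) (u : E -> E) :
  (forall q, linear (A q)) -> (forall x, Cn S k (A^~ x)) -> Cn S k u ->
  Cn S k (fun q => A q (u q)).
Proof.
move=> lA hA hu.
have -> : (fun q => A q (u q)) = (fun q => \sum_i dr_coord i (u q) *: A q (dr_basis i)).
  by apply/funext => q; exact: linear_coord.
apply: Cn_sum => // i; apply: CnZ => //.
exact: (Cn_lin oS (@dr_coord_continuous i)).
Qed.

Lemma Cn_linear (F : normedModType R) k (l : E -> F) (u : E -> E) :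
  linear l -> Cn S k u -> Cn S k (fun q => l (u q)).
Proof. by move=> ll; apply: (@Cn_apply _ _ (fun _ => l)) => // x; exact: Cn_cst. Qed.

Lemma Cn_bilin (F : normedModType R) k (b : E -> E -> F) (u v : E -> E) :
  (forall x, linear (b x)) -> (forall y, linear (b^~ y)) ->
  Cn S k u -> Cn S k v -> Cn S k (fun q => b (u q) (v q)).
Proof.
move=> lr ll hu; apply: (@Cn_apply _ _ (fun q => b (u q))) => // x.
exact: (Cn_linear (ll x)).
Qed.

Lemma Schwarz_vec (f : E -> E) p X Y : S p -> Cn S 2 f ->
  'D_Y (fun q => 'D_X f q) p = 'D_X (fun q => 'D_Y f q) p.
Proof.
move=> Sp hf; apply: dr_coord_inj => i.
have cc := @dr_coord_continuous i.
have hi : Cn S 2 (fun q => dr_coord i (f q)) by exact: Cn_lin.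
have D Z q : S q -> 'D_Z (fun q => dr_coord i (f q)) q = dr_coord i ('D_Z f q).
  by move=> Sq; have [_ e] := der_lin cc (Cn_der Z Sq hf).
have D2 Z W : 'D_W (fun q => 'D_Z (fun q => dr_coord i (f q)) q) p =
    dr_coord i ('D_W (fun q => 'D_Z f q) p).
  have [_ e] := der_lin cc (Cn_der W Sp (Cn_D Z hf)).
  apply: etrans e; apply: near_eq_derive; apply: near_open Sp _ => //; exact: D.
apply: etrans (esym (D2 X Y)) _; apply: etrans _ (D2 Y X); exact: Schwarz hi.
Qed.

End Coordinates.

(** * The left-invariant frame *)

Section Frame.
Context {R : realType} {n m : nat} (J : {linear 'rV[R]_m -> 'M[R]_n}).
Hypothesis hJ : damek_ricci J.
Notation E := (dr_space R n m).
Notation S := (@half_space R n m).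
Implicit Types (p q X Y x y z : E).

Lemma scaleRE (a b : R) : a *: b = a * b. Proof. by []. Qed.

Lemma innerC x y : inner x y = inner y x.
Proof. by rewrite /inner !(dotC y.1.1) !(dotC y.1.2) mulrC. Qed.

Lemma innerDl x y z : inner (x + y) z = inner x z + inner y z.
Proof. by rewrite /inner /= !dotE; ring. Qed.
Lemma innerZl a x z : inner (a *: x) z = a * inner x z.
Proof. by rewrite /inner /= !dotE !scaleRE; ring. Qed.
Lemma innerNl x z : inner (- x) z = - inner x z.
Proof. by rewrite -scaleN1r innerZl mulN1r. Qed.
Lemma innerDr x y z : inner z (x + y) = inner z x + inner z y.
Proof. by rewrite !(innerC z) innerDl. Qed.
Lemma innerZr a x z : inner z (a *: x) = a * inner z x.
Proof. by rewrite !(innerC z) innerZl. Qed.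
Lemma innerNr x z : inner z (- x) = - inner z x.
Proof. by rewrite !(innerC z) innerNl. Qed.

Definition innerE := (innerDl, innerDr, innerNl, innerNr, innerZl, innerZr).

Lemma inner_eq0 x : inner x x = 0 -> x = 0.
Proof.
rewrite /inner => /eqP; rewrite paddr_eq0 ?addr_ge0 ?dot_ge0 // -?expr2 ?sqr_ge0 //.
rewrite paddr_eq0 ?dot_ge0 // !dot_eq0 sqrf_eq0 => /andP[/andP[/eqP a /eqP b] /eqP c].
exact: dr_eq.
Qed.

Lemma inner_inj x y : (forall z, inner x z = inner y z) -> x = y.
Proof.
move=> h; apply/eqP; rewrite -subr_eq0; apply/eqP/inner_eq0.
by rewrite {1}innerDl innerNl h subrr.
Qed.

(** The tangent vector X at p in the left-invariant frame, that is, translated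
    back to the identity; [lpush] is the inverse map. *)
Definition lframe p X : E :=
  ((Num.sqrt p.2)^-1 *: X.1.1, p.2^-1 *: (X.1.2 - 2^-1 *: bracket J p.1.1 X.1.1), p.2^-1 * X.2).

Definition lpush p x : E :=
  (Num.sqrt p.2 *: x.1.1, p.2 *: x.1.2 + (2^-1 * Num.sqrt p.2) *: bracket J p.1.1 x.1.1, p.2 * x.2).

Lemma half_sqrt p : S p -> [/\ Num.sqrt p.2 != 0, p.2 != 0 & p.2 = Num.sqrt p.2 * Num.sqrt p.2].
Proof.
move=> Sp; have p0 : 0 < p.2 by [].
by split; rewrite ?gt_eqF ?sqrtr_gt0 // -expr2 sqr_sqrtr // ltW.
Qed.

Lemma lpush_linear p : linear (lpush p).
Proof.
move=> a x y; apply: dr_eq => /=; last by rewrite !scaleRE; ring.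
  by apply: dot_inj => w; rewrite !dotE; ring.
by apply: dot_inj => w; rewrite !bracketE !dotE; ring.
Qed.

Lemma lframe_linear p : linear (lframe p).
Proof.
move=> a x y; apply: dr_eq => /=; last by rewrite !scaleRE; ring.
  by apply: dot_inj => w; rewrite !dotE; ring.
by apply: dot_inj => w; rewrite !bracketE !dotE; ring.
Qed.

Lemma lframeK p : S p -> cancel (lframe p) (lpush p).
Proof.
move=> /half_sqrt [s0 p0 e] X; apply: dr_eq => /=.
- by rewrite scalerA divff // scale1r.
- apply: dot_inj => w; rewrite !bracketE !dotE; field; rewrite ?s0; exact: p0.
- by rewrite mulVKf.
Qed.

Lemma lpushK p : S p -> cancel (lpush p) (lframe p).
Proof.
move=> /half_sqrt [s0 p0 e] X; apply: dr_eq => /=.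
- by rewrite scalerA mulVf // scale1r.
- apply: dot_inj => w; rewrite !bracketE !dotE; field; rewrite ?s0; exact: p0.
- by rewrite mulKf.
Qed.

Lemma open_half_space : open S.
Proof.
have -> : S = snd @^-1` [set x : R | 0 < x] by [].
apply: open_comp; last exact: open_gt.
by move=> p _; exact: snd_linear_continuous.
Qed.

Lemma ltransE a q : ltrans J a q = (a.1, 0) + lpush a q.
Proof. by apply: dr_eq => //=; rewrite ?add0r // addrA. Qed.

Lemma der_ltrans a p X : der (ltrans J a) p X (lpush a X).
Proof.
rewrite (_ : ltrans J a = fun q => (a.1, 0) + lpush a q); last first.
  by apply/funext => q; exact: ltransE.
rewrite -[lpush a X]add0r; apply: derD; first exact: der_cst.
by apply: der_linear; [exact: lpush_linear | exact: der_id].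
Qed.

Lemma lpush_group_inv p X : S p -> lpush (group_inv p) X = lframe p X.
Proof.
move=> Sp; have p0 : 0 < p.2 by [].
have [s0 t0 e] := half_sqrt Sp.
have es : Num.sqrt p.2^-1 = (Num.sqrt p.2)^-1 by rewrite sqrtrV // ltW.
apply: dr_eq => /=; rewrite ?es //.
apply: dot_inj => w; rewrite !bracketE !dotE; move: s0 e.
move: p.2 (Num.sqrt p.2) => t s s0 ->; field; exact: s0.
Qed.

Lemma dr_metricE p X Y : S p -> dr_metric J p X Y = inner (lframe p X) (lframe p Y).
Proof.
move=> Sp; rewrite /dr_metric !(der_diff (der_ltrans _ _ _)).
by rewrite !lpush_group_inv.
Qed.

Lemma half_space_ltrans a p : S a -> S p -> S (ltrans J a p).
Proof. by move=> Sa Sp; rewrite /half_space /= mulr_gt0. Qed.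

Lemma half_space_inv a : S a -> S (group_inv a).
Proof. by rewrite /half_space /= invr_gt0. Qed.

Lemma ltrans_invl a q : S a -> ltrans J (group_inv a) (ltrans J a q) = q.
Proof.
move=> Sa; have p0 : 0 < a.2 by [].
have [s0 t0 e] := half_sqrt Sa.
have es : Num.sqrt a.2^-1 = (Num.sqrt a.2)^-1 by rewrite sqrtrV // ltW.
apply: dr_eq => /=; rewrite ?es; last by rewrite mulKf.
  by apply: dot_inj => w; rewrite !dotE; field.
apply: dot_inj => w; rewrite !bracketE (bracketvv hJ) !dotE; move: s0 e.
move: a.2 (Num.sqrt a.2) => t s s0 ->; field; exact: s0.
Qed.

Lemma ltrans_invr a q : S a -> ltrans J a (ltrans J (group_inv a) q) = q.
Proof.
move=> Sa; have p0 : 0 < a.2 by [].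
have [s0 t0 e] := half_sqrt Sa.
have es : Num.sqrt a.2^-1 = (Num.sqrt a.2)^-1 by rewrite sqrtrV // ltW.
apply: dr_eq => /=; rewrite ?es; last by rewrite mulVKf.
  by apply: dot_inj => w; rewrite !dotE; field.
apply: dot_inj => w; rewrite !bracketE (bracketvv hJ) !dotE; move: s0 e.
move: a.2 (Num.sqrt a.2) => t s s0 ->; field; exact: s0.
Qed.

Lemma lframe_ltrans a p X : S a -> S p -> lframe (ltrans J a p) (lpush a X) = lframe p X.
Proof.
move=> Sa Sp; have a0 : 0 < a.2 by []; have p0 : 0 < p.2 by [].
have [s0 t0 e] := half_sqrt Sa; have [r0 u0 e'] := half_sqrt Sp.
apply: dr_eq => /=; rewrite ?sqrtrM ?(ltW a0) //.
- by apply: dot_inj => w; rewrite !dotE; field; rewrite r0 s0.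
- apply: dot_inj => w; rewrite !bracketE !dotE.
  move: s0 e u0; move: p.2 a.2 (Num.sqrt a.2) => r t s s0 -> u0; field; rewrite u0; exact: s0.
- by field; rewrite [_ != _]u0 [_ != _]t0.
Qed.

Lemma ltrans_e a : ltrans J a (0, 0, 1) = a.
Proof. by apply: dr_eq => /=; rewrite ?mulr1 ?bracketE ?scaler0 ?addr0. Qed.

(** The Levi-Civita connection on left-invariant fields, from the Koszul formula. *)
Definition nabla x y : E :=
  (- (2^-1 *: (y.1.1 *m J x.1.2 + x.1.1 *m J y.1.2 + y.2 *: x.1.1)),
   2^-1 *: bracket J x.1.1 y.1.1 - y.2 *: x.1.2,
   2^-1 * dot x.1.1 y.1.1 + dot x.1.2 y.1.2).

(** The derivative of [lframe] along x at the vector y, both in frame coordinates;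
    its antisymmetric part is minus the Lie bracket (Maurer-Cartan equation). *)
Definition dframe x y : E :=
  (- (2^-1 * x.2) *: y.1.1, - x.2 *: y.1.2 - 2^-1 *: bracket J x.1.1 y.1.1, - x.2 * y.2).

(** [nabla] is torsion-free: both sides are [y, x]. *)
Lemma dframe_nabla x y : dframe x y - dframe y x = nabla y x - nabla x y.
Proof.
apply: dr_eq => /=.
- by apply: dot_inj => w; rewrite !dotE; lra.
- by apply: dot_inj => w; rewrite !(bracketC hJ y.1.1) !dotE; lra.
- by rewrite !(dotC y.1.1) !(dotC y.1.2); lra.
Qed.

Lemma nabla_skew x y z : inner (nabla x y) z + inner y (nabla x z) = 0.
Proof.
rewrite /inner /= !dotE (dotC y.1.2 (bracket _ _ _)) !dot_bracket.
rewrite (dot_J hJ x.1.2 y.1.1) (dotC y.1.1 x.1.1) (dotC y.1.2 x.1.2).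
by rewrite (dotC y.1.1 (x.1.1 *m _)); ring.
Qed.

Lemma nabla_linear_r x : linear (nabla x).
Proof.
move=> a y z; apply: dr_eq => /=.
- by apply: dot_inj => w; rewrite !actE ?scaleRE !dotE; ring.
- by apply: dot_inj => w; rewrite !bracketE ?scaleRE !dotE; ring.
- by rewrite !dotE ?scaleRE; ring.
Qed.

Lemma nabla_linear_l y : linear (nabla^~ y).
Proof.
move=> a x z; apply: dr_eq => /=.
- by apply: dot_inj => w; rewrite !actE ?scaleRE !dotE; ring.
- by apply: dot_inj => w; rewrite !bracketE ?scaleRE !dotE; ring.
- by rewrite !dotE ?scaleRE; ring.
Qed.

Lemma der_lframe p X Y : S p ->
  der (fun q => lframe q Y) p X (dframe (lframe p X) (lframe p Y)).
Proof.
move=> Sp; have p0 : 0 < p.2 by []; have [s0 t0 e] := half_sqrt Sp.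
have d2 : der (fun q : E => q.2) p X X.2 by apply: der_snd; exact: der_id.
have ds := derV (h := fun q : E => Num.sqrt q.2) s0 (der_sqrt p0 d2).
have dt := derV (h := fun q : E => q.2) t0 d2.
have db : der (fun q : E => Y.1.2 - 2^-1 *: bracket J q.1.1 Y.1.1) p X
   (0 - 2^-1 *: bracket J X.1.1 Y.1.1).
  apply: derB; first exact: der_cst.
  apply: (@der_linear _ _ _ _ _ (fun q : E => 2^-1 *: bracket J q.1.1 Y.1.1)); last exact: der_id.
  by move=> a x y; apply: dot_inj => w; rewrite !bracketE !dotE; ring.
apply: der_eq (der_pair (der_pair (derZ ds (der_cst Y.1.1 p X)) (derZ dt db))
  (derM dt (der_cst Y.2 p X))) _.
apply: dr_eq => /=.
- apply: dot_inj => w; rewrite !dotE; move: s0 e.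
  move: p.2 (Num.sqrt p.2) => t s s0 ->; field; exact: s0.
- apply: dot_inj => w; rewrite !bracketE !dotE; move: s0 e.
  move: p.2 (Num.sqrt p.2) => t s s0 ->; field; exact: s0.
- by field.
Qed.

Variable (k : nat).

Lemma Cn_lframe (f : E -> E) Y : (forall p, S p -> S (f p)) -> Cn S k f ->
  Cn S k (fun q => lframe (f q) Y).
Proof.
move=> Sf hf; have oS := open_half_space.
have h2 := Cn_snd oS hf.
have hV : Cn S k (fun q => (f q).2^-1).
  by apply: CnV => // p Sp; rewrite gt_eqF //; exact: Sf.
apply: Cn_pair => //; first apply: Cn_pair => //; last by apply: CnM => //; exact: Cn_cst.
  apply: CnZ => //; last exact: Cn_cst.
  apply: CnV => // [p Sp|]; first by rewrite gt_eqF // sqrtr_gt0; exact: Sf.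
  by apply: Cn_sqrt => // p Sp; exact: Sf.
apply: CnZ => //; apply: CnB => //; first exact: Cn_cst.
apply: (@Cn_linear _ _ _ _ oS _ _ (fun q : E => 2^-1 *: bracket J q.1.1 Y.1.1)) hf.
by move=> a x y; apply: dot_inj => w; rewrite !bracketE !dotE; ring.
Qed.

Lemma Cn_lpush y : Cn S k (fun q => lpush q y).
Proof.
have oS := open_half_space.
have h2 := Cn_snd oS (Cn_id oS k).
have hs : Cn S k (fun q : E => Num.sqrt q.2) by exact: Cn_sqrt.
apply: Cn_pair => //; last by apply: CnM => //; exact: Cn_cst.
apply: Cn_pair => //; first by apply: CnZ => //; exact: Cn_cst.
apply: CnD => //; first by apply: CnZ => //; exact: Cn_cst.
apply: CnZ => //; first by apply: CnM => //; exact: Cn_cst.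
apply: (@Cn_linear _ _ _ _ oS _ _ (fun q : E => bracket J q.1.1 y.1.1)); last exact: Cn_id.
by move=> a x z; apply: dot_inj => w; rewrite !bracketE !dotE; ring.
Qed.

End Frame.

(** * Symmetric spaces satisfy the J2-condition *)

Lemma linear_sub (R : realType) (U V : lmodType R) (l : U -> V) : linear l ->
  {morph l : x y / x - y}.
Proof. by move=> ll x y; rewrite addrC -scaleN1r ll scaleN1r addrC. Qed.

Lemma linear_0 (R : realType) (U V : lmodType R) (l : U -> V) : linear l -> l 0 = 0.
Proof. by move=> ll; rewrite -(subrr 0) linear_sub // subrr. Qed.

Lemma linear_Z (R : realType) (U V : lmodType R) (l : U -> V) c x : linear l -> l (c *: x) = c *: l x.
Proof. by move=> ll; rewrite -[c *: x]addr0 ll linear_0 // addr0. Qed.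

Lemma linear_add (R : realType) (U V : lmodType R) (l : U -> V) : linear l ->
  {morph l : x y / x + y}.
Proof. by move=> ll x y; have := ll 1 x y; rewrite !scale1r. Qed.

(** Checks an identity of triples componentwise. *)
Ltac dr_ring := apply: dr_eq => /=;
  [apply: dot_inj => ?|apply: dot_inj => ?|];
  rewrite ?(actE, bracketE, dotE, scaleRE) /=; first [ring | lra | by field].

(** The curvature R(x, v)v' of the left-invariant metric, with the Lie bracket
    written as the antisymmetric part of the torsion-free [nabla]. *)
Definition curv3 (R : realType) n m (J : {linear 'rV[R]_m -> 'M[R]_n})
    (x v v' : dr_space R n m) :=
  nabla J (nabla J v x) v' - nabla J (nabla J x v) v'
  + nabla J x (nabla J v v') - nabla J v (nabla J x v').

Section IsometryFrame.
Context {R : realType} {n m : nat} (J : {linear 'rV[R]_m -> 'M[R]_n}).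
Hypothesis hJ : damek_ricci J.
Notation E := (dr_space R n m).
Notation S := (@half_space R n m).
Implicit Types (p q X Y x y z : E).
Variable f : E -> E.
Hypothesis isof : isometry_of S (dr_metric J) f.

Let oS := @open_half_space R n m.
Local Notation nab := (nabla J).

Lemma isometry_Cn k : Cn S k f.
Proof. by apply/Ck_Cn; case: isof => h _ _ _; exact: h. Qed.

Lemma isometry_half p : S p -> S (f p).
Proof. by case: isof => _ h _ _; exact: h. Qed.

(** The pull-back by f of the left-invariant coframe. *)
Definition pullframe q Y : E := lframe J (f q) ('d f q Y).
(** The differential of f read in the left-invariant frames at q and f q. *)
Definition frameop q y : E := pullframe q (lpush J q y).

Lemma pullframe_linear q : linear (pullframe q).
Proof. by move=> a x y; rewrite /pullframe linearP lframe_linear. Qed.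

Lemma frameop_linear q : linear (frameop q).
Proof. by move=> a x y; rewrite /frameop lpush_linear // pullframe_linear. Qed.

Lemma pullframeE q Y : S q -> pullframe q Y = frameop q (lframe J q Y).
Proof. by move=> Sq; rewrite /frameop lframeK. Qed.

Lemma Cn_pullframe k Y : Cn S k (pullframe^~ Y).
Proof.
apply: (@Cn_ext _ _ _ oS _ _ (fun q => lframe J (f q) ('D_Y f q))).
  by move=> q Sq; rewrite /pullframe deriveE //; case: (isometry_Cn 1) => + _; apply.
apply: (@Cn_apply _ _ _ _ oS _ _ (fun q => lframe J (f q))).
- by move=> q; exact: lframe_linear.
- by move=> y; apply: Cn_lframe => //; [exact: isometry_half | exact: isometry_Cn].
- exact: Cn_D (isometry_Cn k.+1).
Qed.

Lemma Cn_frameop k y : Cn S k (frameop^~ y).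
Proof.
apply: (@Cn_apply _ _ _ _ oS _ _ pullframe) => //.
- exact: pullframe_linear.
- exact: Cn_pullframe.
- exact: Cn_lpush.
Qed.

Lemma frameop_isometry q x y : S q -> inner (frameop q x) (frameop q y) = inner x y.
Proof.
move=> Sq; have [_ _ _ hg] := isof.
rewrite /frameop /pullframe -dr_metricE ?hg ?dr_metricE ?lpushK //.
exact: isometry_half.
Qed.

(** The differential of the smooth inverse of f supplies preimages. *)
Lemma frameop_surj q y : S q -> exists x, frameop q x = y.
Proof.
move=> Sq; have [_ Sf [h [sh Sh hf fh]] _] := isof.
have Sfq : S (f q) := Sf _ Sq.
pose Z := lpush J (f q) y.
have dh : der h (f q) Z ('D_Z h (f q)).
  exact: Cn_der Z Sfq ((Ck_Cn S 1 h).1 (sh 1%N)).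
have dfW W : der f (h (f q)) W ('D_W f q).
  by rewrite (hf q Sq); exact: Cn_der W Sq (isometry_Cn 1).
have df := dfW ('D_Z h (f q)).
have [_ e] := der_comp dh df.
have e' : 'D_('D_Z h (f q)) f q = Z.
  have [_ <-] := der_near (near_open oS Sfq fh) (der_comp dh df).
  by rewrite derive_id.
exists (lframe J q ('D_Z h (f q))); rewrite -pullframeE // /pullframe.
rewrite -deriveE; last by case: (isometry_Cn 1) => + _; apply.
by rewrite e' lpushK.
Qed.

(** The derivative of [frameop] at the fixed vector y along the left-invariant
    field x. *)
Definition dframeop q x y : E := 'D_(lpush J q x) (frameop^~ y) q.

Lemma der_frameop q X y : S q -> der (frameop^~ y) q X (dframeop q (lframe J q X) y).
Proof. by move=> Sq; rewrite /dframeop lframeK //; apply: Cn_der Sq (Cn_frameop 1 y). Qed.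

(** The coframe pulled back by f satisfies the same Maurer-Cartan equation as the
    coframe, since second derivatives of f are symmetric. *)
Lemma dframeop_torsion q x y : S q ->
  dframeop q x y - dframeop q y x =
  frameop q (nab x y - nab y x) - (nab (frameop q x) (frameop q y) - nab (frameop q y) (frameop q x)).
Proof.
move=> Sq; pose X := lpush J q x; pose Y := lpush J q y.
have key U V : der (pullframe^~ V) q U (dframeop q (lframe J q U) (lframe J q V)
      + frameop q (dframe J (lframe J q U) (lframe J q V))).
  apply: (@der_near _ _ _ (fun r => frameop r (lframe J r V))).
    by apply: near_open Sq _ => // r Sr; rewrite pullframeE.
  apply: der_apply; first exact: frameop_linear.
    by move=> z; exact: der_frameop.
  exact: der_lframe.
have key2 U V : der (pullframe^~ V) q U
   (dframe J (pullframe q U) (pullframe q V) + lframe J (f q) ('D_U (fun r => 'D_V f r) q)).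
  apply: (@der_near _ _ _ (fun r => lframe J (f r) ('D_V f r))).
    apply: near_open Sq _ => // r Sr.
    by rewrite /pullframe deriveE //; case: (isometry_Cn 1) => + _; apply.
  have -> : pullframe q V = lframe J (f q) ('D_V f q).
    by rewrite /pullframe deriveE //; case: (isometry_Cn 1) => + _; apply.
  apply: (@der_apply _ _ _ _ _ (fun r => lframe J (f r))
    (fun z => dframe J (pullframe q U) (lframe J (f q) z))).
  - by move=> r; exact: lframe_linear.
  - move=> z; have dfU := Cn_der U Sq (isometry_Cn 1).
    have := der_comp (g := fun r => lframe J r z) dfU (der_lframe J _ _ (isometry_half Sq)).
    by rewrite /pullframe -deriveE //; case: (isometry_Cn 1) => + _; apply.
  - exact: Cn_der Sq (Cn_D V (isometry_Cn 2)).
have [H HC main] : exists2 H : E -> E -> E, H X Y = H Y X & forall U V,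
    dframeop q (lframe J q U) (lframe J q V)
      + frameop q (dframe J (lframe J q U) (lframe J q V)) =
    dframe J (pullframe q U) (pullframe q V) + H U V.
  exists (fun U V => lframe J (f q) ('D_U (fun r => 'D_V f r) q)).
    exact: (congr1 (lframe J (f q)) (esym (Schwarz_vec oS X Y Sq (isometry_Cn 2)))).
  by move=> U V; have [_ <-] := key U V; have [_ <-] := key2 U V.
have := main X Y; have := main Y X; rewrite -HC !pullframeE // !lpushK //.
move=> /(canRL (addrK _)) -> /(canRL (addrK _)) ->.
rewrite -!dframe_nabla // (linear_sub (frameop_linear q)).
by apply: inner_inj => w; rewrite !innerE; ring.
Qed.

Lemma dframeop_skew q x y z : S q ->
  inner (dframeop q x y) (frameop q z) + inner (frameop q y) (dframeop q x z) = 0.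
Proof.
move=> Sq; pose X := lpush J q x.
have dB u : der (frameop^~ u) q X (dframeop q x u).
  by have := der_frameop X u Sq; rewrite lpushK.
have := der_bilin (b := @inner R n m) _ _ (dB y) (dB z).
have il (a : E) : linear (inner a) by move=> c u v; rewrite innerDr innerZr.
have ir (a : E) : linear ((@inner R n m)^~ a) by move=> c u v; rewrite innerDl innerZl.
move=> /(_ il ir) d1.
have [_ <-] := d1.
have [_ ->] // : der (fun r => inner (frameop r y) (frameop r z)) q X 0.
apply: (der_near _ (der_cst (inner y z) q X)).
by apply: near_open Sq _ => // r Sr; rewrite frameop_isometry.
Qed.

(** The naturality of the Levi-Civita connection.  The difference of the two sides,
    paired with [frameop q z], is symmetric in x, y by dframeop_torsion and skew in
    y, z by orthogonality; such a trilinear form vanishes. *)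
Lemma dframeopE q x y : S q ->
  dframeop q x y = frameop q (nab x y) - nab (frameop q x) (frameop q y).
Proof.
move=> Sq.
pose d u v := dframeop q u v - (frameop q (nab u v) - nab (frameop q u) (frameop q v)).
have dC u v : d u v = d v u.
  have := dframeop_torsion u v Sq; rewrite /d (linear_sub (frameop_linear q)).
  move: (dframeop q u v) (dframeop q v u) (frameop q (nab u v)) (frameop q (nab v u)).
  move: (nab (frameop q u) (frameop q v)) (nab (frameop q v) (frameop q u)).
  move=> a a' b b' c c' h.
  by apply: inner_inj => w; have := congr1 (fun x => inner x w) h; rewrite /= !innerE; lra.
have ds u v w : inner (d u v) (frameop q w) = - inner (d u w) (frameop q v).
  have := dframeop_skew u v w Sq; have := nabla_skew hJ u v w.
  have := nabla_skew hJ (frameop q u) (frameop q v) (frameop q w).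
  rewrite /d !innerE !frameop_isometry // !(innerC (frameop q v)) (innerC v). lra.
have d0 u v w : inner (d u v) (frameop q w) = 0.
  (* Three cyclic instances of the skewness, as in the Koszul formula. *)
  have h1 := ds u v w; have h2 := ds w u v; have h3 := ds v w u.
  by move: h1 h2 h3; rewrite (dC w u) (dC v w) (dC w v) (dC v u); lra.
suff : d x y = 0 by move/eqP; rewrite subr_eq0 => /eqP.
by apply: inner_eq0; have [w e] := frameop_surj (d x y) Sq; rewrite -{2}e d0.
Qed.

Local Notation k := (curv3 J).

(** R(Z, V)V = - |V|^2/4 Z is preserved by B = [frameop q]: equate the two mixed
    derivatives of B V along the fields V and Z, expanded by dframeopE.  These
    commute, and each has vanishing [dframe] along the other, so no derivative of
    the fields enters. *)
Lemma frameop_curvature q (V : 'rV[R]_n) (Z : 'rV[R]_m) : S q ->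
  k (frameop q (0, Z, 0)) (frameop q (V, 0, 0)) (frameop q (V, 0, 0)) =
  - (4^-1 * dot V V) *: frameop q (0, Z, 0).
Proof.
move=> Sq; set v : E := (V, 0, 0); set z : E := (0, Z, 0).
pose X := lpush J q v; pose Y := lpush J q z.
have vz : nab v z = nab z v.
  by dr_ring.
have dd : dframe J v z = 0 /\ dframe J z v = 0.
  by split; dr_ring.
have dB u w : der (frameop^~ w) q (lpush J q u) (frameop q (nab u w) - nab (frameop q u) (frameop q w)).
  by have := der_frameop (lpush J q u) w Sq; rewrite lpushK // dframeopE.
have dP u w : der (fun r => lframe J r (lpush J q u)) q (lpush J q w) (dframe J w u).
  by have := der_lframe J (lpush J q w) (lpush J q u) Sq; rewrite !lpushK.
have second u w : dframe J w u = 0 ->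
  der (fun r => 'D_(lpush J q u) (frameop^~ v) r) q (lpush J q w)
    (frameop q (nab w (nab u v)) - nab (frameop q w) (frameop q (nab u v)) -
     (nab (frameop q (nab w u) - nab (frameop q w) (frameop q u)) (frameop q v)
      + nab (frameop q u) (frameop q (nab w v) - nab (frameop q w) (frameop q v)))).
  move=> wu0.
  apply: (@der_near _ _ _ (fun r => frameop r (nab (lframe J r (lpush J q u)) v) -
      nab (frameop r (lframe J r (lpush J q u))) (frameop r v))).
    apply: near_open Sq _ => // r Sr.
    by have [_ ->] := der_frameop (lpush J q u) v Sr; rewrite dframeopE.
  have lq u' : lframe J q (lpush J q u') = u' by rewrite lpushK.
  have dPu : der (fun r => lframe J r (lpush J q u)) q (lpush J q w) 0.
    by rewrite -wu0; exact: dP.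
  have f0 := linear_0 (frameop_linear q).
  have n0 := linear_0 (nabla_linear_l J v).
  have e1 := der_apply frameop_linear (dB w) (der_linear (nabla_linear_l J v) dPu).
  have e2 := der_apply frameop_linear (dB w) dPu.
  move: e1 e2; rewrite lq n0 f0 !addr0 => e1 e2.
  have := derB e1 (der_bilin (nabla_linear_r J) (nabla_linear_l J) e2 (dB w v)).
  by rewrite lq.
have := Schwarz_vec oS X Y Sq (Cn_frameop 2 v).
have [_ e1] := second v z dd.2; have [_ e2] := second z v dd.1.
move=> sch; have := etrans (esym e1) (etrans sch e2).
clear sch e1 e2; rewrite vz.
have -> : nab v v = (0, 0, 2^-1 * dot V V).
  by rewrite /nabla /= (bracketvv hJ); dr_ring.
have -> : nab z (0, 0, 2^-1 * dot V V) = - (2^-1 * dot V V) *: z by dr_ring.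
have -> : nab z v = (- (2^-1 *: (V *m J Z)), 0, 0) by dr_ring.
have -> : nab v (- (2^-1 *: (V *m J Z)), 0, 0) = - (4^-1 * dot V V) *: z.
  rewrite /nabla /= ?(bracketE, dotE) (bracket_J hJ) (dotC V (V *m _)) (dot_J_same hJ); dr_ring.
have nBl a b c : nab (a - b) c = nab a c - nab b c := linear_sub (nabla_linear_l J c) a b.
have nBr a b c : nab c (a - b) = nab c a - nab c b := linear_sub (nabla_linear_r J c) a b.
rewrite !(linear_Z _ _ (frameop_linear q)) /curv3.
move: (frameop q z) (frameop q v) (frameop q _) (frameop q _) => a b c d.
rewrite !nBl !nBr => h.
apply: inner_inj => w; have := congr1 (fun a => inner a w) h.
by rewrite /= !innerE; lra.
Qed.

Hypothesis fe : f (0, 0, 1) = (0, 0, 1).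
Hypothesis dfe : forall X, 'd f ((0, 0, 1) : E) X = - X.
Let e : E := (0, 0, 1).

Lemma frameop_e y : frameop e y = - y.
Proof.
rewrite /frameop /pullframe fe dfe.
by apply: dr_eq; rewrite /= ?sqrtr1 ?invr1 ?bracketE ?(oppr0, scaler0, subr0, addr0) ?scale1r ?mul1r.
Qed.

Lemma lframe_e y : lframe J e y = y.
Proof.
by apply: dr_eq; rewrite /= ?sqrtr1 ?invr1 ?bracketE ?scaler0 ?(subr0, addr0) ?scale1r ?mul1r.
Qed.

(** The derivative of frameop_curvature at e along w.  There B = -1 and, by
    dframeopE, the derivative of B y is - 2 nabla w y, so the common factor -2 drops
    out. *)
Lemma curvature_parallel (V : 'rV[R]_n) (Z : 'rV[R]_m) w :
  - (4^-1 * dot V V) *: nab w (0, Z, 0) =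
  k (nab w (0, Z, 0)) (V, 0, 0) (V, 0, 0) +
  k (0, Z, 0) (nab w (V, 0, 0)) (V, 0, 0) + k (0, Z, 0) (V, 0, 0) (nab w (V, 0, 0)).
Proof.
set v : E := (V, 0, 0); set z : E := (0, Z, 0).
have Se : S e by rewrite /half_space /=.
have lN (l : E -> E) x : linear l -> l (- x) = - l x.
  by move=> ll; rewrite -scaleN1r linear_Z // scaleN1r.
have nNl a b : nab (- a) b = - nab a b := lN _ a (nabla_linear_l J b).
have nNr a b : nab a (- b) = - nab a b := lN _ b (nabla_linear_r J a).
have dB u : der (frameop^~ u) e w (- (nab w u + nab w u)).
  have := der_frameop w u Se; rewrite dframeopE // lframe_e !frameop_e nNl nNr opprK.
  by rewrite -opprD.
have nl := nabla_linear_l J; have nr := nabla_linear_r J.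
have dv := dB v; have dz := dB z.
have d1 := der_bilin nr nl dv dz.
have d2 := der_bilin nr nl dz dv.
have d3 := der_bilin nr nl dv dv.
have dk := derB (derD (derB (der_bilin nr nl d1 dv) (der_bilin nr nl d2 dv))
   (der_bilin nr nl dz d3)) (der_bilin nr nl dv d2).
have dc := derZ (der_cst (- (4^-1 * dot V V)) e w) dz.
have near_eq : \near e, k (frameop e z) (frameop e v) (frameop e v) = - (4^-1 * dot V V) *: frameop e z.
  by apply: near_open Se _ => // r Sr; exact: frameop_curvature.
have [_ e1] := der_near near_eq dk.
have := etrans (esym dc.2) e1.
clear dc e1 near_eq dk d1 d2 d3 dv dz; rewrite !frameop_e /curv3 scale0r add0r.
have nDl a b c : nab (a + b) c = nab a c + nab b c := linear_add (nl c) a b.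
have nDr a b c : nab c (a + b) = nab c a + nab c b := linear_add (nr c) a b.
have nZl c a b : nab (c *: a) b = c *: nab a b := linear_Z c a (nl b).
have nZr c a b : nab b (c *: a) = c *: nab b a := linear_Z c a (nr b).
move: z v (nab w z) (nab w v) => z v bz bv.
rewrite !(nDl, nDr, nNl, nNr) => h.
apply: inner_inj => u; have := congr1 (fun a => inner a u) h.
by rewrite /= !innerE; lra.
Qed.

(** For w = J_Y V, the v-component of curvature_parallel is 3/8 times this
    identity. *)
Lemma parallel_J2 (V : 'rV[R]_n) (X Y : 'rV[R]_m) : dot X Y = 0 ->
  dot V V *: (V *m J Y *m J X) = V *m J (bracket J V (V *m J Y *m J X)).
Proof.
move=> XY; set T := V *m J Y *m J X; set C := bracket J V T.
have VT : dot V T = 0.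
  have := dot_J hJ X V (V *m J Y); rewrite -dot_bracket (bracket_J hJ) dotZl dotC XY.
  by rewrite -/T; lra.
have VY : dot (V *m J Y) V = 0 by rewrite (dot_J_same hJ).
have Tanti : V *m J X *m J Y = - T.
  have := JJ_anticomm hJ X Y V; rewrite XY mulr0 oppr0 scale0r => /eqP.
  by rewrite addr_eq0 => /eqP.
set b := dot V V.
have := curvature_parallel V X (V *m J Y, 0, 0).
set v : E := (V, 0, 0); set z : E := (0, X, 0); set w : E := (V *m J Y, 0, 0).
have -> : nab w z = (- (2^-1 *: T), 0, 0) by rewrite /T; dr_ring.
have -> : nab w v = (0, - (2^-1 * b) *: Y, 0).
  by rewrite /nabla /= (bracketC hJ) (bracket_J hJ) VY -/b; dr_ring.
have -> : k (- (2^-1 *: T), 0, 0) v v = (3 / 8 *: (V *m J C) + 8^-1 * b *: T, 0, 0).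
  have e1 : nab v (- (2^-1 *: T), 0, 0) = (0, - (4^-1 *: C), 0).
    by rewrite /C /nabla /= dotNr dotZr VT; dr_ring.
  have e2 : nab (- (2^-1 *: T), 0, 0) v = (0, 4^-1 *: C, 0).
    by rewrite /C /nabla /= dotNl dotZl (dotC T) VT bracketNl bracketZl (bracketC hJ T); dr_ring.
  have e3 : nab v v = (0, 0, 2^-1 * b).
    by rewrite /b /nabla /= (bracketvv hJ); dr_ring.
  by rewrite /curv3 e1 e2 e3; dr_ring.
have -> : k z (0, - (2^-1 * b) *: Y, 0) v = (- (4^-1 * b) *: T, 0, 0).
  have e1 : nab (0, - (2^-1 * b) *: Y, 0) z = 0.
    by rewrite /nabla /= dotZl (dotC Y) XY; dr_ring.
  have e2 : nab z (0, - (2^-1 * b) *: Y, 0) = 0.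
    by rewrite /nabla /= dotZr XY; dr_ring.
  have e3 : nab (0, - (2^-1 * b) *: Y, 0) v = (4^-1 * b *: (V *m J Y), 0, 0) by dr_ring.
  have e4 : nab z v = (- (2^-1 *: (V *m J X)), 0, 0) by dr_ring.
  have e5 : nab z (4^-1 * b *: (V *m J Y), 0, 0) = (- (8^-1 * b) *: T, 0, 0) by rewrite /T; dr_ring.
  have e6 : nab (0, - (2^-1 * b) *: Y, 0) (- (2^-1 *: (V *m J X)), 0, 0) = (8^-1 * b *: T, 0, 0).
    by rewrite /nabla /= !actE Tanti; dr_ring.
  rewrite /curv3 e1 e2 e3 e4 e5 e6 (linear_0 (nabla_linear_l J v)).
  dr_ring.
have -> : k z v (0, - (2^-1 * b) *: Y, 0) = (- (8^-1 * b) *: T, 0, 0).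
  have e1 : nab v z = nab z v by dr_ring.
  have e2 : nab z (0, - (2^-1 * b) *: Y, 0) = 0.
    by rewrite /nabla /= dotZr XY; dr_ring.
  have e3 : nab v (0, - (2^-1 * b) *: Y, 0) = (4^-1 * b *: (V *m J Y), 0, 0) by dr_ring.
  have e5 : nab z (4^-1 * b *: (V *m J Y), 0, 0) = (- (8^-1 * b) *: T, 0, 0) by rewrite /T; dr_ring.
  rewrite /curv3 e1 e2 e3 e5 (linear_0 (nabla_linear_r J v)) subrr add0r subr0 //.
move=> /(congr1 (fun x : E => x.1.1)) /= h.
apply: dot_inj => u; have := congr1 (fun x' : 'rV[R]_n => dot x' u) h; rewrite /= !dotE -/b.
by lra.
Qed.

End IsometryFrame.

Lemma symmetric_J2 (R : realType) n m (J : {linear 'rV[R]_m -> 'M[R]_n}) :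
  damek_ricci J -> symmetric_space (@half_space R n m) (dr_metric J) -> J2_condition J.
Proof.
move=> hJ /(_ (0, 0, 1)) [|f [isof fe dfe]]; first by rewrite /half_space /= ltr01.
move=> V X Y.
have [->|V0] := eqVneq V 0; first by exists 0, 0; rewrite !mul0mx scaler0 addr0.
have [->|Y0] := eqVneq Y 0.
  by exists 0, 0; rewrite linear0 mulmx0 mul0mx scale0r addr0.
(* Split X into its component along Y, where J_Y^2 is a scalar, and the rest. *)
pose a := dot X Y / dot Y Y; pose X' := X - a *: Y.
have X'Y : dot X' Y = 0 by rewrite !dotE /a divfK ?subrr // dot_eq0.
have -> : X = a *: Y + X' by rewrite addrC subrK.
have h := parallel_J2 hJ isof fe dfe V X'Y.
rewrite actDr actZr (Jsq hJ); apply: cliff_spanD.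
  by do 2!apply: cliff_spanZ; exact: cliff_span_refl.
rewrite -[_ *m J X']scale1r -(@mulVf _ (dot V V)) ?dot_eq0 // -scalerA h.
by apply: cliff_spanZ; exact: cliff_spanJ.
Qed.

(** * Algebra of the geodesic inversion *)

Section InversionAlgebra.
Context {R : realType} {n m : nat} (J : {linear 'rV[R]_m -> 'M[R]_n}).
Hypothesis hJ : damek_ricci J.

(** The operator a + J_Z on v. *)
Definition qact (a : R) (Z : 'rV[R]_m) (V : 'rV[R]_n) := a *: V + V *m J Z.

Lemma dot_qact a Z (x y : 'rV[R]_n) :
  dot (qact a Z x) (qact a Z y) = (a ^+ 2 + dot Z Z) * dot x y.
Proof.
rewrite /qact !dotE (dot_JJ hJ) (dot_J hJ Z x); ring.
Qed.

Lemma dot_qact2 a Z b X (x : 'rV[R]_n) :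
  dot (qact a Z x) (qact b X x) = (a * b + dot Z X) * dot x x.
Proof.
rewrite /qact !dotE (dot_J_same hJ) (dotC x) (dot_J_same hJ) -dot_bracket (bracket_J hJ).
by rewrite !dotE (dotC X); ring.
Qed.

(** A point (V, Z, t) with a tangent vector (v, z, s), and their images under the
    inversion and its differential (primed), tied only by the defining relations of
    the image point and the derivatives of these relations. *)
Variables (V V' v v' : 'rV[R]_n) (Z Z' z z' : 'rV[R]_m) (t t' s s' : R).
Let tau := t + 4^-1 * dot V V.
Let D := tau ^+ 2 + dot Z Z.
Let dtau := s + 2^-1 * dot V v.
Let dD := 2 * tau * dtau + 2 * dot Z z.
Hypothesis t0 : 0 < t.
Hypothesis eV : qact tau Z V' = - V.
Hypothesis dV : qact dtau z V' + qact tau Z v' = - v.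
Hypothesis et : D * t' = t.
Hypothesis dt : dD * t' + D * s' = s.
Hypothesis eZ : D *: Z' = - Z.
Hypothesis dZ : dD *: Z' + D *: z' = - z.

Let w2 := z - 2^-1 *: bracket J V v.
Let w2' := z' - 2^-1 *: bracket J V' v'.

Lemma inv_tau_gt0 : 0 < tau.
Proof. by rewrite ltr_wpDr // mulr_ge0 ?dot_ge0. Qed.

Lemma inv_D_gt0 : 0 < D.
Proof. by rewrite ltr_wpDr ?dot_ge0 // exprn_gt0 // inv_tau_gt0. Qed.

Lemma inv_norm : D * dot V' V' = dot V V.
Proof. by rewrite -dot_qact eV !dotE; ring. Qed.

Lemma inv_dnorm : dD * dot V' V' + 2 * D * dot V' v' = 2 * dot V v.
Proof.
have : dot (- V) (- v) = dot V v by rewrite !dotE; ring.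
rewrite -eV -dV dotDr dot_qact2 dot_qact => <-.
by rewrite /dD /D; ring.
Qed.

(** The derivative of q V' = - V is q v' = - v - dq V', and q scales norms by the
    square root of D. *)
Lemma inv_dV_norm :
  D * dot v' v' = dot v v + 2 * dot (qact dtau z V') v + (dtau ^+ 2 + dot z z) * dot V' V'.
Proof.
rewrite -[D * _](dot_qact tau Z) -[X in _ + X](dot_qact dtau z).
move: (qact dtau z V') dV => a e.
have -> : qact tau Z v' = - v - a by rewrite -e addrC addKr.
by rewrite !dotE (dotC v a); ring.
Qed.

Lemma inv_s' : s' = s / D - dD * t / D ^+ 2.
Proof.
have D0 : D != 0 by rewrite gt_eqF // inv_D_gt0.
have -> : s' = (s - dD * t') / D by rewrite -dt; field.
have -> : t' = t / D by rewrite -et; field.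
by field.
Qed.

Lemma inv_z' : z' = - D^-1 *: z + (dD / D ^+ 2) *: Z.
Proof.
have D0 : D != 0 by rewrite gt_eqF // inv_D_gt0.
apply: dot_inj => w; have := congr1 (fun x => dot x w) dZ; have := congr1 (fun x => dot x w) eZ.
rewrite /= !dotE; move: (dot Z' w) (dot z' w) (dot Z w) (dot z w) D D0 => a b c d E E0 h1 h2.
have -> : b = (- d - dD * a) / E by rewrite -h2; field.
have -> : a = - c / E by rewrite -h1; field.
by field.
Qed.

Section J2.
Hypothesis h2 : J2_condition J.
Hypothesis V0 : V != 0.

(** V' = - (tau - J_Z) V / D. *)
Lemma inv_span : cliff_span J V V'.
Proof.
have D0 : D != 0 by rewrite gt_eqF // inv_D_gt0.
exists (- D^-1 * tau), (D^-1 *: Z).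
rewrite -[V]opprK -eV /qact; apply: dot_inj => w.
rewrite !(actE, dotE) (Jsq hJ) !dotE.
have -> : dot Z Z = D - tau ^+ 2 by rewrite /D; ring.
by field.
Qed.

Lemma inv_V'0 : V' != 0.
Proof.
have D0 : D != 0 by rewrite gt_eqF // inv_D_gt0.
by rewrite -dot_eq0 -(mulrI_eq0 _ (mulfI D0)) inv_norm dot_eq0.
Qed.

(** K_V' = K_V, so both sides are multiples of one projection; the factors agree
    because |V|^2 = D |V'|^2. *)
Lemma inv_proj : D *: cliff_proj J V' v' = cliff_proj J V v'.
Proof.
have V'n : dot V' V' != 0 by rewrite dot_eq0 inv_V'0.
apply: (scalerI V'n); rewrite -(cliff_proj_change hJ h2 v' inv_V'0 inv_span).
by rewrite scalerA mulrC inv_norm.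
Qed.

Lemma inv_proj_v' :
  qact tau Z (cliff_proj J V v') = - cliff_proj J V v - dot V V *: qact dtau z V'.
Proof.
have sp : cliff_span J V (qact dtau z V').
  rewrite /qact; apply: cliff_spanD; first by apply: cliff_spanZ; exact: inv_span.
  exact: (cliff_span_act h2 z inv_span).
have pD a b : cliff_proj J V (a + b) = cliff_proj J V a + cliff_proj J V b.
  by rewrite /cliff_proj; apply: dot_inj => w; rewrite !(dotE, bracketE, actE, dotE); ring.
have pZ c a : cliff_proj J V (c *: a) = c *: cliff_proj J V a.
  by rewrite /cliff_proj; apply: dot_inj => w; rewrite !(dotE, bracketE, actE, dotE); ring.
have pN a : cliff_proj J V (- a) = - cliff_proj J V a by rewrite -scaleN1r pZ scaleN1r.
rewrite -(cliff_proj_id hJ sp) [LHS]/qact -(cliff_proj_act hJ h2) // -pZ -!pN -!pD -/(qact tau Z v').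
by congr (cliff_proj J V _); rewrite -dV addrC addKr.
Qed.

(** With q = tau + J_Z and dq = dtau + J_z this is
    D q (s' + J_w2') V' = - 2t dq V' - (s + J_w2) V: it expresses the image of the
    tangent vector in the directions z + a, acting on V', through the original one
    and determines its norm. *)
Lemma inv_key :
  D *: qact tau Z (qact s' w2' V') = - (2 * t *: qact dtau z V' + qact s w2 V).
Proof.
have D0 : D != 0 by rewrite gt_eqF // inv_D_gt0.
apply: (scalerI D0).
have hp := inv_proj_v'; have hd := inv_dnorm; have hn := inv_norm.
(* Multiplying by D twice clears all denominators of s' and z'. *)
have e1 : (D ^+ 2) *: qact s' w2' V' =
   (D * dtau - dD * tau) *: V' - D *: (V' *m J z) + dD *: (V' *m J Z)
   - 2^-1 * D *: cliff_proj J V v'.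
  rewrite -inv_proj /qact /w2' /cliff_proj actDr actNr actZr inv_z' actDr !actZr inv_s'.
  have -> : dtau = s + 2^-1 * ((dD * dot V' V' + 2 * D * dot V' v') / 2) by rewrite hd /dtau; field.
  have -> : tau = t + 4^-1 * (D * dot V' V') by rewrite hn.
  by apply: dot_inj => w; rewrite !dotE; field.
have qZ a X c x : qact a X (c *: x) = c *: qact a X x.
  by rewrite /qact; apply: dot_inj => w; rewrite !(actE, dotE); ring.
have qD a X x y : qact a X (x + y) = qact a X x + qact a X y.
  by rewrite /qact; apply: dot_inj => w; rewrite !(actE, dotE); ring.
have e0 W : D *: (D *: qact tau Z W) = qact tau Z (D ^+ 2 *: W).
  by rewrite scalerA -expr2 qZ.
have qN a X x : qact a X (- x) = - qact a X x by rewrite -scaleN1r qZ scaleN1r.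
move: hp e1; move: (cliff_proj J V v') => P hp e1.
rewrite e0 e1 !(qD, qN, qZ) hp.
have -> : qact tau Z (V' *m J Z) = (tau ^+ 2 *: V' + tau *: (V' *m J Z)) - D *: V'.
  rewrite /qact (Jsq hJ) /D; apply: dot_inj => w; rewrite !dotE; ring.
have -> : qact tau Z (V' *m J z) = 2 * tau *: (V' *m J z) + V *m J z - 2 * dot Z z *: V'.
  have := JJ_anticomm hJ z Z V' => /(canRL (addrK _)); rewrite /qact => ->.
  rewrite -[V in RHS]opprK -eV /qact; apply: dot_inj => w.
  by rewrite !(actE, dotE) (dotC z Z); ring.
have eJ : V' *m J Z = - V - tau *: V' by rewrite -eV /qact addrC addKr.
rewrite eV eJ /cliff_proj /w2 /dD /qact.
have -> : 2 * t = 2 * tau - 2^-1 * dot V V by rewrite /tau; field.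
have -> : s *: V = dtau *: V - 2^-1 * dot V v *: V by rewrite -scalerBl /dtau addrK.
rewrite !(actE, bracketE); apply: dot_inj => w; rewrite !dotE.
by move: dtau tau D => dtau1 tau1 D1; field.
Qed.

Lemma inv_w2_norm :
  D ^+ 2 * (s' ^+ 2 + dot w2' w2') * dot V V =
  4 * t ^+ 2 * (dtau ^+ 2 + dot z z) * dot V' V'
  - 4 * t * (tau * (dtau ^+ 2 + dot z z) * dot V' V' + 2^-1 * dot V V * dot (qact dtau z V') v)
  + (s ^+ 2 + dot w2 w2) * dot V V.
Proof.
have := congr1 (fun x => dot x x) inv_key; rewrite /= !(dotZl, dotZr) dot_qact.
rewrite -/D dot_qact2 -expr2 => h.
transitivity (D * (D * (D * ((s' * s' + dot w2' w2') * dot V' V')))).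
  by rewrite -inv_norm !expr2; ring.
rewrite h; have e : qact s w2 V = qact dtau z V - 2^-1 *: cliff_proj J V v.
  rewrite /qact /w2 /cliff_proj /dtau !actE; apply: dot_inj => w; rewrite !dotE; ring.
have c1 : dot (qact dtau z V') (qact s w2 V) =
   - (tau * (dtau ^+ 2 + dot z z) * dot V' V') - 2^-1 * dot V V * dot (qact dtau z V') v.
  rewrite e dotDr dotNr dotZr dot_qact (cliff_proj_orth hJ); last first.
    rewrite /qact; apply: cliff_spanD; first by apply: cliff_spanZ; exact: inv_span.
    exact: (cliff_span_act h2 z inv_span).
  have -> : dot V' V = - (tau * dot V' V').
    have := congr1 (dot V') eV; rewrite /qact !dotE (dotC V' (V' *m _)) (dot_J_same hJ).
    by lra.
  ring.
have na := dot_qact dtau z V' V'; have nb := dot_qact s w2 V V.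
move: na nb c1; clear h e; move: (qact dtau z V') (qact s w2 V) (dot w2 w2) => a b W na nb c1.
by rewrite !dotE (dotC b a) c1 na nb; field.
Qed.

End J2.

(** For V nonzero, add the norms of inv_dV_norm and inv_w2_norm; the mixed terms in
    <dq V', v> cancel, and the remaining ones by |V|^2 = 4 (tau - t).  For V = 0
    also V' = 0, and only the inversion of (t, Z) in R + z is involved. *)
Lemma inv_isometry : J2_condition J ->
  dot v' v' / t' + (dot w2' w2' + s' ^+ 2) / t' ^+ 2 =
  dot v v / t + (dot w2 w2 + s ^+ 2) / t ^+ 2.
Proof.
move=> h2; have D0 : D != 0 by rewrite gt_eqF // inv_D_gt0.
have tn0 : t != 0 by rewrite gt_eqF.
have -> : t' = t / D by rewrite -et; field.
have hv := inv_dV_norm; have hn := inv_norm.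
have [V0|V0] := eqVneq V 0.
  have V'0 : V' = 0.
    apply/eqP; rewrite -dot_eq0; apply/eqP/(mulfI D0).
    by rewrite hn V0 dot0l mulr0.
  have a1 : tau = t by rewrite /tau V0 dot0l mulr0 addr0.
  have a2 : dtau = s by rewrite /dtau V0 dot0l mulr0 addr0.
  have a3 : dot v' v' = dot v v / D.
    have <- : D * dot v' v' = dot v v by rewrite hv V'0 /qact scaler0 act0l !dotE; ring.
    by field.
  have a4 : w2 = z by rewrite /w2 V0 bracket0l scaler0 subr0.
  have a5 : w2' = - D^-1 *: z + (dD / D ^+ 2) *: Z.
    by rewrite /w2' V'0 bracket0l scaler0 subr0 inv_z'.
  have a6 : dD = 2 * (t * s + dot Z z) by rewrite /dD a1 a2; ring.
  have a7 : dot Z Z = D - t ^+ 2 by rewrite /D a1; ring.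
  rewrite a3 a4 a5 inv_s' !dotE a6 a7 (dotC z Z).
  by move: D D0 => D1 D10; field; rewrite tn0 D10.
have V'n : dot V V != 0 by rewrite dot_eq0.
have h3 := inv_w2_norm h2 V0.
have -> : dot w2' w2' + s' ^+ 2 = (D ^+ 2 * (s' ^+ 2 + dot w2' w2') * dot V V) / dot V V / D ^+ 2.
  by field; rewrite D0.
have -> : dot v' v' = (D * dot v' v') / D by field.
rewrite h3 hv.
have e4 : dot V V = 4 * (tau - t) by rewrite /tau; field.
have tt : tau - t != 0.
  by apply: contra_neq V'n => h; rewrite e4 h mulr0.
have -> : dot V' V' = dot V V / D by rewrite -hn; field.
rewrite e4; move: (dot (qact dtau z V') v) => b.
move: dtau D D0 tau tt => dtau1 D1 D10 tau1 tt; field.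
by rewrite D10 tn0 tt.
Qed.

End InversionAlgebra.

(** * The J2-condition yields geodesic symmetries *)

Section Inversion.
Context {R : realType} {n m : nat} (J : {linear 'rV[R]_m -> 'M[R]_n}).
Hypothesis hJ : damek_ricci J.
Notation E := (dr_space R n m).
Notation S := (@half_space R n m).
Implicit Types (p q X Y x y z : E).

Let oS := @open_half_space R n m.

Definition inv_tau p : R := p.2 + 4^-1 * dot p.1.1 p.1.1.
Definition inv_den p : R := inv_tau p ^+ 2 + dot p.1.2 p.1.2.
(** In terms of q = tau + J_Z, the map sends V to - q^-1 V and q to q^-1. *)
Definition inversion p : E :=
  ((inv_den p)^-1 *: (p.1.1 *m J p.1.2 - inv_tau p *: p.1.1),
   - ((inv_den p)^-1 *: p.1.2), (inv_den p)^-1 * p.2).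

Lemma inv_den_gt0 p : S p -> 0 < inv_den p.
Proof. exact: inv_D_gt0. Qed.

Lemma half_space_inversion p : S p -> S (inversion p).
Proof. by move=> Sp; rewrite /half_space /= mulr_gt0 // invr_gt0 inv_den_gt0. Qed.

Lemma inversion_V p : S p -> qact J (inv_tau p) p.1.2 (inversion p).1.1 = - p.1.1.
Proof.
move=> /inv_den_gt0 D0; have {}D0 : inv_den p != 0 by rewrite gt_eqF.
rewrite /qact /=; apply: dot_inj => w; rewrite !(actE, dotE) (Jsq hJ) !dotE.
have -> : dot p.1.2 p.1.2 = inv_den p - inv_tau p ^+ 2 by rewrite /inv_den; ring.
by field.
Qed.

Lemma inversion_Z p : S p -> inv_den p *: (inversion p).1.2 = - p.1.2.
Proof.
by move=> /inv_den_gt0 D0; rewrite /= scalerN scalerA mulfV ?scale1r // gt_eqF.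
Qed.

Lemma inversion_t p : S p -> inv_den p * (inversion p).2 = p.2.
Proof. by move=> /inv_den_gt0 D0; rewrite /= mulVKf // gt_eqF. Qed.

Lemma inversion_tau p : S p -> inv_den p * inv_tau (inversion p) = inv_tau p.
Proof.
move=> Sp; rewrite /inv_tau mulrDr inversion_t //; congr (_ + _).
rewrite mulrCA; congr (_ * _).
by have := dot_qact hJ (inv_tau p) p.1.2 (inversion p).1.1 (inversion p).1.1;
  rewrite inversion_V // dotNl dotNr opprK.
Qed.

Lemma inversionK p : S p -> inversion (inversion p) = p.
Proof.
move=> Sp; have D0 := inv_den_gt0 Sp; have {}D0 : inv_den p != 0 by rewrite gt_eqF.
have et : inv_tau (inversion p) = (inv_den p)^-1 * inv_tau p by rewrite -(inversion_tau Sp) mulKf.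
have ed : inv_den (inversion p) = (inv_den p)^-1.
  rewrite {1}/inv_den et /= !dotE.
  have -> : dot p.1.2 p.1.2 = inv_den p - inv_tau p ^+ 2 by rewrite /inv_den; ring.
  by field.
have eV := inversion_V Sp.
rewrite {1}/inversion ed et invrK; apply: dr_eq.
- rewrite [LHS]/= -[RHS]opprK -eV /qact; apply: dot_inj => w.
  by rewrite !(actE, dotE); field.
- by rewrite /= scalerN opprK scalerA mulfV // scale1r.
- by rewrite /= mulVKf.
Qed.

Lemma dot11_bilinear :
  (forall x : E, linear (fun y : E => dot x.1.1 y.1.1)) /\
  (forall y : E, linear (fun x : E => dot x.1.1 y.1.1)).
Proof. by split=> x a y z; rewrite /= !dotE scaleRE. Qed.

Lemma dot12_bilinear :
  (forall x : E, linear (fun y : E => dot x.1.2 y.1.2)) /\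
  (forall y : E, linear (fun x : E => dot x.1.2 y.1.2)).
Proof. by split=> x a y z; rewrite /= !dotE scaleRE. Qed.

Lemma act_bilinear :
  (forall x : E, linear (fun y : E => x.1.1 *m J y.1.2)) /\
  (forall y : E, linear (fun x : E => x.1.1 *m J y.1.2)).
Proof. by split=> x a y z; rewrite /= !actE. Qed.

Lemma Cn_inversion k (u : E -> E) : (forall q, S q -> S (u q)) -> Cn S k u ->
  Cn S k (fun q => inversion (u q)).
Proof.
move=> Su hu.
have h11 := Cn_fst oS (Cn_fst oS hu); have h12 := Cn_snd oS (Cn_fst oS hu).
have h2 := Cn_snd oS hu.
have ht : Cn S k (fun q => inv_tau (u q)).
  apply: CnD => //; apply: CnM => //; first exact: Cn_cst.
  exact: (Cn_bilin oS dot11_bilinear.1 dot11_bilinear.2 hu hu).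
have hd : Cn S k (fun q => (inv_den (u q))^-1).
  apply: CnV => // [q Sq|]; first by rewrite gt_eqF // inv_den_gt0 //; exact: Su.
  apply: CnD => //; last exact: (Cn_bilin oS dot12_bilinear.1 dot12_bilinear.2 hu hu).
  by apply: (Cn_ext oS (f := fun q => inv_tau (u q) * inv_tau (u q))) => [q _|]; [rewrite expr2|exact: CnM].
apply: Cn_pair => //; last exact: CnM.
apply: Cn_pair => //; last by apply: CnN => //; exact: CnZ.
apply: CnZ => //; apply: CnB => //; last exact: CnZ.
exact: (Cn_bilin oS act_bilinear.1 act_bilinear.2 hu hu).
Qed.

Lemma der_inversion p X : S p -> der inversion p X ('D_X inversion p).
Proof.
move=> Sp; apply: (Cn_der X Sp (k := 0)).
by apply: (@Cn_inversion 1 (fun q => q)) => //; exact: Cn_id.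
Qed.

Lemma der_inv_tau p X : der inv_tau p X (X.2 + 2^-1 * dot p.1.1 X.1.1).
Proof.
have did := der_id p X.
have h := derD (der_snd did)
  (derM (der_cst (4^-1 : R) p X) (der_bilin dot11_bilinear.1 dot11_bilinear.2 did did)).
by apply: (der_eq h); rewrite (dotC X.1.1); lra.
Qed.

Lemma der_inv_den p X : S p ->
  der inv_den p X (2 * inv_tau p * (X.2 + 2^-1 * dot p.1.1 X.1.1) + 2 * dot p.1.2 X.1.2).
Proof.
move=> Sp; have did := der_id p X; have dt := der_inv_tau p X.
have h := derD (derM dt dt) (der_bilin dot12_bilinear.1 dot12_bilinear.2 did did).
apply: der_eq (der_near _ h) _; last by rewrite (dotC X.1.2); ring.
by apply: (near_open oS Sp) => q _; rewrite /inv_den expr2.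
Qed.

Lemma lframe_quad p X : S p ->
  inner (lframe J p X) (lframe J p X) =
  dot X.1.1 X.1.1 / p.2 +
  (dot (X.1.2 - 2^-1 *: bracket J p.1.1 X.1.1) (X.1.2 - 2^-1 *: bracket J p.1.1 X.1.1)
   + X.2 ^+ 2) / p.2 ^+ 2.
Proof.
move=> Sp; have [s0 t0 e] := half_sqrt Sp.
rewrite /inner /lframe; cbn [fst snd]; rewrite !(dotZl, dotZr).
have -> : p.2^-1 = (Num.sqrt p.2)^-1 * (Num.sqrt p.2)^-1 by rewrite -invfM -e.
move: (dot _ (X.1.2 - _)) (dot X.1.1 X.1.1) => a b.
move: s0 e; move: p.2 (Num.sqrt p.2) => t s s0 e.
by rewrite {1}e; field.
Qed.

(** The derivatives of V', Z', t' are obtained by differentiating the polynomial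
    relations inversion_V, inversion_Z, inversion_t rather than the quotients. *)
Lemma inversion_isometry p X : J2_condition J -> S p ->
  inner (lframe J (inversion p) ('D_X inversion p)) (lframe J (inversion p) ('D_X inversion p))
  = inner (lframe J p X) (lframe J p X).
Proof.
move=> h2 Sp; have Si := half_space_inversion Sp.
rewrite !lframe_quad //.
have di := der_inversion X Sp.
set X' := 'D_X inversion p in di *.
have did := der_id p X.
have dt := der_inv_tau p X; have dd := der_inv_den X Sp.
apply: (inv_isometry hJ (V := p.1.1) (t := p.2) (Z' := (inversion p).1.2)) => //.
- exact: inversion_V.
- have d1 := derD (derZ dt (der_fst (der_fst di))) (der_bilin act_bilinear.1 act_bilinear.2 di did).
  have d2 := derN (der_fst (der_fst did)).
  have d3 := der_near (near_open oS Sp inversion_V) d1.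
  apply: etrans _ (etrans (esym d3.2) d2.2).
  rewrite /qact -/(inv_tau p); move: (inversion p) => p'.
  by apply: dot_inj => w; rewrite !dotE; ring.
- exact: inversion_t.
- have d1 := derM dd (der_snd di).
  have d3 := der_near (near_open oS Sp inversion_t) d1.
  exact: etrans (esym d3.2) (der_snd did).2.
- exact: inversion_Z.
- have d1 := derZ dd (der_snd (der_fst di)).
  have d3 := der_near (near_open oS Sp inversion_Z) d1.
  exact: etrans (esym d3.2) (derN (der_snd (der_fst did))).2.
Qed.

Lemma inversion_e : inversion (0, 0, 1) = (0, 0, 1).
Proof.
rewrite /inversion /inv_den /inv_tau /=; apply: dr_eq => /=; rewrite ?dotE.
- by rewrite act0l scaler0 subr0 scaler0.
- by rewrite scaler0 oppr0.
- by rewrite mulr0 !addr0 expr1n invr1 mulr1.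
Qed.

Lemma inv_den_e : inv_den (0, 0, 1) = 1.
Proof. by rewrite /inv_den /inv_tau /= !dotE mulr0 !addr0 expr1n. Qed.

Lemma der_inversion_e X : der inversion ((0, 0, 1) : E) X (- X).
Proof.
have Se : S ((0, 0, 1) : E) by rewrite /half_space /= ltr01.
have did := der_id ((0, 0, 1) : E) X.
have d0 : inv_den ((0, 0, 1) : E) != 0 by rewrite inv_den_e oner_neq0.
have dd := derV d0 (der_inv_den X Se).
have h := der_pair (der_pair
   (derZ dd (derB (der_bilin act_bilinear.1 act_bilinear.2 did did)
      (derZ (der_inv_tau _ X) (der_fst (der_fst did)))))
   (derN (derZ dd (der_snd (der_fst did))))) (derM dd (der_snd did)).
apply: (der_eq h); rewrite inv_den_e /inv_tau; apply: dr_eq => /=.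
- by apply: dot_inj => w; rewrite !(actE, dotE); field.
- by apply: dot_inj => w; rewrite !(actE, dotE); field.
- by rewrite !dotE; field.
Qed.

Definition geodesic_symmetry p q : E := ltrans J p (inversion (ltrans J (group_inv p) q)).

Lemma der_symmetry p q X : S p -> S q ->
  der (geodesic_symmetry p) q X
    (lpush J p ('D_(lpush J (group_inv p) X) inversion (ltrans J (group_inv p) q))).
Proof.
move=> Sp Sq; apply: (@der_comp _ _ _ _ (ltrans J p)); last exact: der_ltrans.
apply: (@der_comp _ _ _ _ inversion); first exact: der_ltrans.
by apply: der_inversion; apply: half_space_ltrans => //; exact: half_space_inv.
Qed.

Lemma half_space_symmetry p q : S p -> S q -> S (geodesic_symmetry p q).
Proof.
move=> Sp Sq; apply: half_space_ltrans => //; apply: half_space_inversion.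
by apply: half_space_ltrans => //; exact: half_space_inv.
Qed.

Lemma symmetry_involutive p q : S p -> S q -> geodesic_symmetry p (geodesic_symmetry p q) = q.
Proof.
move=> Sp Sq; rewrite /geodesic_symmetry ltrans_invl // inversionK ?ltrans_invr //.
by apply: half_space_ltrans => //; exact: half_space_inv.
Qed.

Lemma symmetry_smooth p : S p -> smooth_on S (geodesic_symmetry p).
Proof.
move=> Sp k; apply/Ck_Cn.
have Cl a (u : E -> E) : Cn S k u -> Cn S k (fun q => ltrans J a (u q)).
  move=> hu; apply: (Cn_ext oS (f := fun q => (a.1, 0) + lpush J a (u q))).
    by move=> q _; rewrite ltransE.
  apply: CnD => //; first exact: Cn_cst.
  by apply: (Cn_linear oS _ hu); exact: lpush_linear.
apply: (Cl p); apply: Cn_inversion; last by apply: (Cl (group_inv p)); exact: Cn_id.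
by move=> q Sq; apply: half_space_ltrans => //; exact: half_space_inv.
Qed.

(** By polarisation it is enough to compare the quadratic forms. *)
Lemma symmetry_isometry p : J2_condition J -> S p ->
  isometry_of S (dr_metric J) (geodesic_symmetry p).
Proof.
move=> h2 Sp; have Sy q (Sq : S q) := half_space_symmetry Sp Sq.
split=> //; first exact: symmetry_smooth.
  exists (geodesic_symmetry p); split=> //; first exact: symmetry_smooth.
    by move=> q Sq; exact: symmetry_involutive.
  by move=> q Sq; exact: symmetry_involutive.
move=> q Sq X Y.
pose L Z := lframe J (geodesic_symmetry p q) ('d (geodesic_symmetry p) q Z).
have LD Z W : L (Z + W) = L Z + L W.
  by rewrite /L linearD (linear_add (lframe_linear _ _)).
have quad Z : inner (L Z) (L Z) = inner (lframe J q Z) (lframe J q Z).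
  have Sr : S (ltrans J (group_inv p) q).
    by apply: half_space_ltrans => //; exact: half_space_inv.
  rewrite /L (der_diff (der_symmetry Z Sp Sq)) lframe_ltrans //; last exact: half_space_inversion.
  rewrite inversion_isometry // lframe_ltrans //; exact: half_space_inv.
have := quad (X + Y).
rewrite (linear_add (lframe_linear J q)) LD !innerE !quad.
rewrite !dr_metricE //; last exact: Sy.
rewrite -/(L X) -/(L Y) (innerC (L Y)) (innerC (lframe J q Y)); lra.
Qed.

Lemma J2_symmetric : J2_condition J -> symmetric_space S (dr_metric J).
Proof.
move=> h2 p Sp; exists (geodesic_symmetry p).
have lp : ltrans J (group_inv p) p = (0, 0, 1).
  by rewrite -{2}(ltrans_e J p) ltrans_invl.
split; first exact: symmetry_isometry.
  by rewrite /geodesic_symmetry lp inversion_e ltrans_e.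
move=> X; rewrite (der_diff (der_symmetry X Sp Sp)) lp.
have [_ ->] := der_inversion_e (lpush J (group_inv p) X).
rewrite lpush_group_inv // -[X in RHS](lframeK J Sp X).
by rewrite -scaleN1r (linear_Z _ _ (lpush_linear J p)) scaleN1r.
Qed.

End Inversion.

(** * Focal varieties and orthogonal geodesics *)

Section Focal.
Context {R : realType} {n m : nat} (J : {linear 'rV[R]_m -> 'M[R]_n}).
Hypothesis hJ : damek_ricci J.
Notation E := (dr_space R n m).
Notation S := (@half_space R n m).
Implicit Types (p q X Y x y z : E) (v : 'rV[R]_n).

(** The variety through q in terms of q: only the direction v remains. *)
Lemma focalE p v s q : focal J p v s q ->
  focal J p v s = [set q' | [/\ S q', bracket J (q'.1.1 - q.1.1) v = 0 &
    dot (q'.1.1 - q.1.1) v = 0]].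
Proof.
move=> [Sq b d]; apply/seteqP; split=> q' /= [Sq' b' d']; split=> //.
- rewrite (_ : _ - _ = (q'.1.1 - p.1.1) - (q.1.1 - p.1.1)); last by rewrite opprB addrA subrK.
  by rewrite bracketDl bracketNl b b' subr0.
- rewrite (_ : _ - _ = (q'.1.1 - p.1.1) - (q.1.1 - p.1.1)); last by rewrite opprB addrA subrK.
  by rewrite dotDl dotNl d d' subrr.
- rewrite (_ : _ - _ = (q'.1.1 - q.1.1) + (q.1.1 - p.1.1)); last by rewrite addrA subrK.
  by rewrite bracketDl b b' addr0.
- rewrite (_ : _ - _ = (q'.1.1 - q.1.1) + (q.1.1 - p.1.1)); last by rewrite addrA subrK.
  by rewrite dotDl d d' add0r.
Qed.

Lemma focal_tangent p v s q Y : focal J p v s q ->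
  bracket J Y.1.1 v = 0 -> dot Y.1.1 v = 0 -> tangent_vectors (focal J p v s) q Y.
Proof.
move=> Fq b d; rewrite (focalE Fq); have [Sq _ _] := Fq.
have da : der (fun r : R => q + r *: Y) 0 (1 : R) Y.
  apply: (der_eq (derD (der_cst q (0 : R) (1 : R))
    (derZ (der_id (0 : R) (1 : R)) (der_cst Y (0 : R) (1 : R))))).
  by rewrite add0r scaler0 addr0 scale1r.
exists (fun r => q + r *: Y); split; first by rewrite scale0r addr0.
  have ca : (q + r *: Y) @[r --> (0 : R)] --> q + (0 : R) *: Y.
    exact: differentiable_continuous da.1.
  rewrite scale0r addr0 in ca.
  have near_S : \forall r \near (0 : R), S (q + r *: Y).
    exact: ca _ (open_nbhs_nbhs (conj (@open_half_space R n m) Sq)).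
  apply: filterS near_S => r Sr.
  have e : (q + r *: Y).1.1 - q.1.1 = r *: Y.1.1 by rewrite /= addrC addKr.
  by split=> //; rewrite e ?bracketZl ?b ?scaler0 // dotZl d mulr0.
by have [/diff_derivable h1 h2] := da; split.
Qed.

(** Testing the velocity against tangent vectors in z + a kills these components,
    and testing it against the complement of K_v puts the rest into K_v. *)
Lemma orthogonal_span p v s c t : v != 0 -> geodesic S (dr_metric J) c ->
  meets_orthogonally (dr_metric J) (focal J p v s) c t ->
  (lframe J (c t) (c^`() t)).1.1 != 0 /\ cliff_span J v (lframe J (c t) (c^`() t)).1.1.
Proof.
move=> v0 /(_ t) [Sq _ _ X0 _] [Fq h].
have orth y : bracket J y.1.1 v = 0 -> dot y.1.1 v = 0 -> inner (lframe J (c t) (c^`() t)) y = 0.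
  move=> b d; have := h (lpush J (c t) y); rewrite dr_metricE // lpushK //.
  apply; apply: focal_tangent => //=; first by rewrite bracketZl b scaler0.
  by rewrite dotZl d mulr0.
move: orth; set x := lframe J (c t) (c^`() t) => orth.
have : inner ((0, x.1.2, x.2) : E) (0, x.1.2, x.2) = 0.
  have h0 := orth (0, x.1.2, x.2) (bracket0l _ _) (dot0l _).
  by move: h0; rewrite /inner /= dot0r dot0l.
move/inner_eq0 => /(congr1 (fun y : E => (y.1.2, y.2))) [x2 x3].
split.
  apply: contra_neq X0 => x1; rewrite -[LHS](lframeK J Sq) -/x.
  have -> : x = 0 by exact: dr_eq.
  exact: (linear_0 (lpush_linear _ _)).
apply: (cliff_span_bidual hJ v0) => k d b.
have := orth (k, 0, 0) b d.
by rewrite /inner /= dot0r mulr0 !addr0 dotC.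
Qed.

Lemma J2_focal (p1 p2 : E) (v1 v2 : 'rV[R]_n) (s1 s2 : R) c t : J2_condition J ->
  v1 != 0 -> v2 != 0 -> geodesic S (dr_metric J) c ->
  meets_orthogonally (dr_metric J) (focal J p1 v1 s1) c t ->
  meets_orthogonally (dr_metric J) (focal J p2 v2 s2) c t ->
  focal J p1 v1 s1 = focal J p2 v2 s2.
Proof.
move=> h2 v10 v20 gc m1 m2.
have [x0 sp1] := orthogonal_span v10 gc m1; have [_ sp2] := orthogonal_span v20 gc m2.
rewrite (focalE m1.1) (focalE m2.1).
have W v w : w != 0 -> cliff_span J v w -> forall k,
    (dot k v = 0 /\ bracket J k v = 0) <-> (dot k w = 0 /\ bracket J k w = 0).
  move=> w0 vw k; rewrite -!(orth_cliff_span hJ); split=> h l hl; apply: h.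
    exact: (cliff_span_trans h2 vw hl).
  exact: (cliff_span_trans h2 (cliff_span_sym hJ w0 vw) hl).
have W12 k := iff_trans (W _ _ x0 sp1 k) (iff_sym (W _ _ x0 sp2 k)).
apply/seteqP; split=> q [Sq b d].
  by have [] := (W12 _).1 (conj d b).
by have [] := (W12 _).2 (conj d b).
Qed.

(** The Koszul formula: in the left-invariant frame the first-kind Christoffel
    symbol is the derivative of the frame corrected by [nabla]. *)
Lemma christoffelE p X Y W : S p -> christoffel (dr_metric J) p X Y W =
  inner (dframe J (lframe J p X) (lframe J p Y) + nabla J (lframe J p X) (lframe J p Y))
    (lframe J p W).
Proof.
move=> Sp.
have il (a : E) : linear (inner a) by move=> c u v; rewrite innerDr innerZr.
have ir (a : E) : linear ((@inner R n m)^~ a) by move=> c u v; rewrite innerDl innerZl.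
have D U A B : 'D_U (fun q => dr_metric J q A B) p =
   inner (dframe J (lframe J p U) (lframe J p A)) (lframe J p B) +
   inner (lframe J p A) (dframe J (lframe J p U) (lframe J p B)).
  have d := der_bilin il ir (der_lframe J U A Sp) (der_lframe J U B Sp).
  have [_ <-] := d; apply: near_eq_derive.
  by apply: near_open Sp _; [exact: open_half_space | move=> q Sq; rewrite dr_metricE].
rewrite /christoffel !D.
move: (lframe J p X) (lframe J p Y) (lframe J p W) => x y w.
have e1 := congr1 (inner y) (dframe_nabla hJ x w).
have e2 := congr1 (inner x) (dframe_nabla hJ y w).
have e3 := congr1 (inner w) (dframe_nabla hJ y x).
have k1 := nabla_skew hJ x y w; have k2 := nabla_skew hJ y x w; have k3 := nabla_skew hJ w y x.
move: e1 e2 e3 k1 k2 k3; rewrite !innerE ?(innerC w) ?(innerC (nabla _ _ _) x) ?(innerC (nabla _ _ _) y)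
  ?(innerC (dframe _ _ _) x) ?(innerC (dframe _ _ _) y); lra.
Qed.

End Focal.

(** * Geodesics from the identity, and the theorem *)

Section Geodesic.
Context {R : realType} {n m : nat} (J : {linear 'rV[R]_m -> 'M[R]_n}).
Hypothesis hJ : damek_ricci J.
Notation E := (dr_space R n m).
Notation S := (@half_space R n m).

(** 2 tanh (r/2), the V-coordinate of the unit speed geodesic from the identity with
    velocity in v; [geo_y] is its t-coordinate 1 - tanh^2 (r/2). *)
Definition geo_x (r : R) : R := 2 * ((expR r - 1) * (expR r + 1)^-1).
Definition geo_y (r : R) : R := 4 * (expR r * ((expR r + 1)^-1 * (expR r + 1)^-1)).

Lemma expR1_neq0 (r : R) : expR r + 1 != 0.
Proof. by rewrite gt_eqF // addr_gt0 // expR_gt0. Qed.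

Lemma geo_y_gt0 r : 0 < geo_y r.
Proof. by rewrite !mulr_gt0 ?expR_gt0 // invr_gt0 addr_gt0 // expR_gt0. Qed.

Lemma der_exp (r : R) : der (@expR R) r (1 : R) (expR r).
Proof. by have := der_R (1 : R) (is_derive_expR r); rewrite mul1r. Qed.

Lemma der_geo_x r : der geo_x r (1 : R) (geo_y r).
Proof.
have n0 := expR1_neq0 r; have de := der_exp r.
have dp := derD de (der_cst (1 : R) r (1 : R)).
have dm := derB de (der_cst (1 : R) r (1 : R)).
apply: (der_eq (derM (der_cst (2 : R) r (1 : R)) (derM dm (derV (h := fun r => expR r + 1) n0 dp)))).
by rewrite /geo_y; field.
Qed.

Lemma der_geo_y r : der geo_y r (1 : R) (- (2^-1 * (geo_x r * geo_y r))).
Proof.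
have n0 := expR1_neq0 r; have de := der_exp r.
have dp := derD de (der_cst (1 : R) r (1 : R)).
have dv := derV (h := fun r => expR r + 1) n0 dp.
apply: (der_eq (derM (der_cst (4 : R) r (1 : R)) (derM de (derM dv dv)))).
by rewrite /geo_y /geo_x; field.
Qed.

Variable u : 'rV[R]_n.
Hypothesis u1 : dot u u = 1.

Definition geo (r : R) : E := (geo_x r *: u, 0, geo_y r).

Lemma u_neq0 : u != 0.
Proof. by rewrite -dot_eq0 u1 oner_neq0. Qed.

Lemma der_curve (a b : R -> R) r a' b' : der a r (1 : R) a' -> der b r (1 : R) b' ->
  der (fun r => (a r *: u, 0, b r) : E) r (1 : R) (a' *: u, 0, b').
Proof.
move=> da db.
apply: (der_eq (der_pair (der_pair (derZ da (der_cst u r (1 : R)))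
  (der_cst (0 : 'rV[R]_m) r (1 : R))) db)).
by rewrite scaler0 addr0.
Qed.

Lemma der_geo r : der geo r (1 : R) (geo_y r *: u, 0, - (2^-1 * (geo_x r * geo_y r))).
Proof. exact: der_curve (der_geo_x r) (der_geo_y r). Qed.

(** The geodesic equation for this curve follows from the system x' = y,
    y' = - x y / 2 of its coordinates. *)
Lemma geo_geodesic : geodesic S (dr_metric J) geo.
Proof.
have e1 : geo^`() = fun r => (geo_y r *: u, 0, - (2^-1 * (geo_x r * geo_y r))) : E.
  by apply/funext => r; rewrite derive1E; have [_ ->] := der_geo r.
have d2 r : der (geo^`()) r (1 : R)
    (- (2^-1 * (geo_x r * geo_y r)) *: u, 0,
     - (2^-1 * (geo_y r * geo_y r - 2^-1 * (geo_x r ^+ 2 * geo_y r)))).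
  rewrite e1; apply: (der_eq (der_curve (der_geo_y r)
    (derN (derM (der_cst (2^-1 : R) r (1 : R)) (derM (der_geo_x r) (der_geo_y r)))))).
  by congr (_, _); ring.
move=> r; have Sr : S (geo r) := geo_y_gt0 r.
have y0 := geo_y_gt0 r.
split=> //.
- by have [h _] := der_geo r; exact: diff_derivable.
- by have [h _] := d2 r; exact: diff_derivable.
- rewrite e1; apply/negP => /eqP /(congr1 (fun x : E => x.1.1)) /= /eqP.
  by rewrite scaler_eq0 (negbTE u_neq0) gt_eqF.
move=> W; rewrite derive1E (d2 r).2 christoffelE // dr_metricE // -innerDl e1.
set a := lframe _ _ _; set b := lframe _ _ _ in a *.
rewrite [X in inner X _](_ : _ = 0); first by rewrite /inner /= !dot0l mul0r !addr0.
rewrite {}/a {}/b /lframe /geo /=.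
have bu : bracket J u u = 0 := bracketvv hJ u.
have s0 : Num.sqrt (geo_y r) != 0 by rewrite gt_eqF // sqrtr_gt0.
have e : geo_y r = Num.sqrt (geo_y r) * Num.sqrt (geo_y r) by rewrite -expr2 sqr_sqrtr // ltW.
move: e s0; move: (geo_x r) (geo_y r) (Num.sqrt (geo_y r)) => x y s -> s0.
rewrite /dframe /nabla /= !bracketE bu.
apply: dr_eq => /=.
- by apply: dot_inj => w; rewrite !(actE, dotE); field.
- by apply: dot_inj => w; rewrite !(actE, dotE); field.
- by rewrite !dotE u1; field.
Qed.

Lemma geo0 : geo 0 = (0, 0, 1).
Proof. by rewrite /geo /geo_x /geo_y expR0 subrr mul0r mulr0 scale0r; congr (_, _); field. Qed.

Lemma dgeo0 : geo^`() 0 = (u, 0, 0).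
Proof.
rewrite derive1E; have [_ ->] := der_geo 0.
by rewrite /geo_x /geo_y expR0 subrr !mul0r !mulr0 mul0r mulr0 oppr0; congr (_, _, _);
  rewrite -[RHS]scale1r; congr (_ *: _); field.
Qed.

End Geodesic.

Section FocalJ2.
Context {R : realType} {n m : nat} (J : {linear 'rV[R]_m -> 'M[R]_n}).
Hypothesis hJ : damek_ricci J.
Notation E := (dr_space R n m).
Notation S := (@half_space R n m).
Let e : E := (0, 0, 1).

Lemma focal_e v (q : E) : focal J e v 0 q <-> [/\ S q, bracket J q.1.1 v = 0 & dot q.1.1 v = 0].
Proof.
by rewrite /focal /= subr0 mulr0 mul0r.
Qed.

Lemma tangent_focal_e v (Y : E) : tangent_vectors (focal J e v 0) e Y ->
  dot Y.1.1 v = 0 /\ bracket J Y.1.1 v = 0.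
Proof.
move=> [a [a0 Fa [da1 da2]]].
have da : der a 0 (1 : R) Y by split=> //; exact/derivable1_diffP.
have lb : linear (fun q : E => bracket J q.1.1 v).
  by move=> c x y; rewrite /= !bracketE.
have ld : linear (fun q : E => dot q.1.1 v) by move=> c x y; rewrite /= !dotE scaleRE.
have d1 := der_linear lb da; have d2 := der_linear ld da.
have n1 : \forall r \near (0 : R), bracket J (a r).1.1 v = 0.
  by apply: filterS Fa => r /focal_e [].
have n2 : \forall r \near (0 : R), dot (a r).1.1 v = 0.
  by apply: filterS Fa => r /focal_e [].
split.
  by rewrite -(der_near0 (1 : R) n2).2 -d2.2.
by rewrite -(der_near0 (1 : R) n1).2 -d1.2.
Qed.

Definition unit_vec (v : 'rV[R]_n) := (Num.sqrt (dot v v))^-1 *: v.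

Lemma dot_unit_vec v : v != 0 -> dot (unit_vec v) (unit_vec v) = 1.
Proof.
rewrite -dot_gt0 => v0; have s0 : Num.sqrt (dot v v) != 0 by rewrite gt_eqF // sqrtr_gt0.
rewrite /unit_vec dotZl dotZr -[X in _ * (_ * X)](@sqr_sqrtr _ (dot v v)) ?ltW //.
by rewrite expr2; field.
Qed.

Lemma direction_unit_vec v : v != 0 -> direction (unit_vec v) 0.
Proof.
move=> v0; split; last by rewrite dot_unit_vec // expr0n addr0.
by rewrite -dot_eq0 dot_unit_vec // oner_neq0.
Qed.

(** Apply the property at the identity to the varieties with directions V and J_Y V
    and to the geodesic with initial velocity along J_Y V. *)
Lemma focal_J2 :
  (forall (p1 p2 : E) (v1 v2 : 'rV[R]_n) (s1 s2 : R),
     S p1 -> S p2 -> direction v1 s1 -> direction v2 s2 ->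
     forall (c : R -> E) (t : R),
       geodesic S (dr_metric J) c ->
       meets_orthogonally (dr_metric J) (focal J p1 v1 s1) c t ->
       meets_orthogonally (dr_metric J) (focal J p2 v2 s2) c t ->
       focal J p1 v1 s1 = focal J p2 v2 s2) -> J2_condition J.
Proof.
move=> H V X Y.
have [->|V0] := eqVneq V 0; first by exists 0, 0; rewrite !mul0mx scaler0 addr0.
have [->|w0] := eqVneq (V *m J Y) 0.
  by exists 0, 0; rewrite mul0mx act0r scale0r addr0.
pose v1 := unit_vec V; pose v2 := unit_vec (V *m J Y).
have Se : S e by rewrite /half_space /= ltr01.
have u2 : dot v2 v2 = 1 := dot_unit_vec w0.
have cV : V = Num.sqrt (dot V V) *: v1.
  by rewrite /v1 /unit_vec scalerA divff ?scale1r // gt_eqF // sqrtr_gt0 dot_gt0.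
have Fe v : focal J e v 0 e.
  by apply/focal_e; split=> //; rewrite /= ?bracket0l ?dot0l.
have orth v : cliff_span J v v2 -> meets_orthogonally (dr_metric J) (focal J e v 0) (geo v2) 0.
  move=> sp; rewrite /meets_orthogonally geo0 dgeo0; split=> // Z /tangent_focal_e tz.
  rewrite dr_metricE // !lframe_e /inner /= dot0l mul0r !addr0.
  exact: (orth_cliff_span hJ v _).2 tz _ sp.
have sp1 : cliff_span J v1 v2.
  rewrite /v2 /unit_vec; apply: cliff_spanZ; rewrite {1}cV actZl; apply: cliff_spanZ.
  exact: cliff_spanJ.
have F12 := H _ _ _ _ _ _ Se Se (direction_unit_vec V0) (direction_unit_vec w0) _ 0
  (geo_geodesic hJ u2) (orth _ sp1) (orth _ (cliff_span_refl _ _)).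
have v1n : v1 != 0 by have [] := direction_unit_vec V0.
have : cliff_span J v1 (v2 *m J X).
  apply: (cliff_span_bidual hJ v1n) => k d b.
  (* A vector k orthogonal to K_v1 is the v-component of a point of the first,
     hence of the second variety, so it is orthogonal to K_v2. *)
  have : focal J e v1 0 (k, 0, 1) by apply/focal_e; split.
  rewrite F12 => /focal_e [_ b2 _].
  by rewrite dotC -dot_bracket (bracketC hJ) b2 oppr0 dot0l.
move=> sp; rewrite /cliff_span.
have -> : V *m J Y = Num.sqrt (dot (V *m J Y) (V *m J Y)) *: v2.
  by rewrite /v2 /unit_vec scalerA divff ?scale1r // gt_eqF // sqrtr_gt0 dot_gt0.
rewrite actZl; apply: cliff_spanZ.
have [c [Z ->]] := sp; exists (c / Num.sqrt (dot V V)), ((Num.sqrt (dot V V))^-1 *: Z).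
by rewrite /v1 /unit_vec actZl actZr scalerA.
Qed.

End FocalJ2.

Theorem theorem9p4 (R : realType) (n m : nat)
    (J : {linear 'rV[R]_m -> 'M[R]_n}) (hJ : damek_ricci J) :
  symmetric_space (@half_space R n m) (dr_metric J) <->
  (forall (p1 p2 : dr_space R n m) (v1 v2 : 'rV[R]_n) (s1 s2 : R),
     half_space p1 -> half_space p2 -> direction v1 s1 -> direction v2 s2 ->
     forall (c : R -> dr_space R n m) (t : R),
       geodesic (@half_space R n m) (dr_metric J) c ->
       meets_orthogonally (dr_metric J) (focal J p1 v1 s1) c t ->
       meets_orthogonally (dr_metric J) (focal J p2 v2 s2) c t ->
       focal J p1 v1 s1 = focal J p2 v2 s2).
Proof.
split=> [sym p1 p2 v1 v2 s1 s2 _ _ [v10 _] [v20 _] c t|H].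
  exact: (J2_focal hJ (symmetric_J2 hJ sym)).
exact: (J2_symmetric hJ (focal_J2 hJ H)).
Qed.
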